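(* Let $P(s)=\dfrac{s-z}{s-p}$ with $p>0$, $z>0$. Then $$\log_{10}k_M=2\log_{10}k_M^{PI}=2\log_{10}k_M^{P},\qquad \theta_M=2\theta_M^{PI}=2\theta_M^{P}.$$
   Context: Controllers: $K_P(s)=k_p$; $K_{PI}(s)=k_p+k_i/s$, with real coefficients (possibly zero). A general LTI controller is any real rational function $K(s)$. Stabilization (unity negative feedback): write the plant as $P=N_P/D_P$ with numerator and denominator polynomials exactly as displayed (no cancellation of common factors is performed) and a controller as $K=N_K/D_K$ with $N_K,D_K$ coprime real polynomials. For a nonzero complex number $c$, $K$ stabilizes $cP$ if $\deg(N_PN_K)\le\deg(D_PD_K)$ and the closed-loop characteristic polynomial $D_PD_K+cN_PN_K$ has degree $\deg(D_PD_K)$ and all its roots in the open left half-plane. Margins: $k_M=\sup\{\mu:\ \exists K \text{ stabilizing } \alpha P \text{ for all }\alpha\in[1,\mu)\}$ and $\theta_M=\sup\{\eta\in[0,\pi]:\ \exists K\text{ stabilizing } e^{-j\theta}P\text{ for all }\theta\in(-\eta,\eta)\}$ over all general LTI controllers $K$ ($j=\sqrt{-1}$; one and the same controller must work for the whole range); $k_M^{X},\theta_M^{X}$ for $X\in\{P,PI\}$ are the same suprema with $K$ restricted to type $X$. *)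

(* Defs.v *)
From HB Require Import structures.
From mathcomp Require Import all_boot all_order all_algebra.
From mathcomp Require Import complex.
From mathcomp Require Import all_classical all_reals all_analysis.

Set Implicit Arguments.
Unset Strict Implicit.
Unset Printing Implicit Defensive.

Import Order.TTheory GRing.Theory Num.Theory.

Local Open Scope classical_set_scope.
Local Open Scope ring_scope.

Definition controller (R : realType) : Type := {fraction {poly R}}.

Definition ctrlP (R : realType) : set (controller R) :=
  [set K | exists kp : R, K = tofrac kp%:P].

Definition ctrlPI (R : realType) : set (controller R) :=
  [set K | exists kp ki : R, K = tofrac kp%:P + tofrac ki%:P / tofrac 'X].

(* [NP] and [DP] are not reduced to lowest terms, so a common factor of the
   plant stays in the characteristic polynomial.  Degrees are compared through
   [size], which is 1 + degree on nonzero polynomials and 0 at 0.  The coprime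
   pair [(NK, DK)] exists for every [K] and is unique up to a common nonzero
   constant, which does not affect the remaining conditions. *)
Definition stabilizes (R : realType) (NP DP : {poly R}) (c : R[i])
    (K : controller R) : Prop :=
  exists NK DK : {poly R},
    let chi := map_poly (real_complex R) (DP * DK)
               + c *: map_poly (real_complex R) (NP * NK) in
    [/\ [/\ DK != 0, coprimep NK DK & K = tofrac NK / tofrac DK],
        (size (NP * NK)%R <= size (DP * DK)%R)%N,
        size chi = size (DP * DK)
      & forall s : R[i], root chi s -> complex.Re s < 0].

Definition expNi (R : realType) (theta : R) : R[i] :=
  Complex (cos theta) (- sin theta).

(* The set of admissible [mu] may be unbounded for a general plant, hence the
   extended-real supremum.  It always contains every [mu <= 1], for which
   [1, mu) is empty. *)
Definition gain_margin (R : realType) (X : set (controller R))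
    (NP DP : {poly R}) : \bar R :=
  ereal_sup [set mu%:E | mu in
    [set mu : R | exists2 K, X K &
       forall alpha : R, 1 <= alpha -> alpha < mu ->
         stabilizes NP DP (real_complex R alpha) K]].

Definition phase_margin (R : realType) (X : set (controller R))
    (NP DP : {poly R}) : R :=
  sup [set eta : R | (0 <= eta <= pi) /\
    exists2 K, X K &
      forall theta : R, - eta < theta -> theta < eta ->
        stabilizes NP DP (expNi theta) K].

Definition log10 (R : realType) (x : \bar R) : \bar R :=
  (lne x * ((ln 10)^-1)%:E)%E.

(* Main.v *)
Require Import Defs.
From HB Require Import structures.
From mathcomp Require Import all_boot all_order all_algebra.
From mathcomp Require Import complex.
From mathcomp Require Import all_classical all_reals all_analysis.
From mathcomp Require Import zify ring lra.

Set Implicit Arguments.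
Unset Strict Implicit.
Unset Printing Implicit Defensive.

Import Order.TTheory GRing.Theory Num.Theory.

Local Open Scope classical_set_scope.
Local Open Scope ring_scope.

(* Put m = sqrt(p z), r = max(p/z, z/p) and a = atan(|z - p| / (2 m)).  The
   margins are r^2 and 2 a over all controllers, r and a over P and PI.

   Upper bounds over all controllers.  The extremal closed loops of
   Nevanlinna-Pick theory are rational here: the gain bound compares the ratio
   of two closed-loop polynomials with s^2 / z^2 or its inverse, the phase bound
   compares (N - D) / (N + D) with multiples of (M - s^2) / s, for N / D the loop
   transfer function and M between z^2 and p z.  Either comparison gives a segment
   of complex polynomials without root on the imaginary axis, because a root
   there would be a closed-loop pole for an admissible gain or phase.  The
   segment starts at (s + z) times a closed-loop polynomial, which is Hurwitz,
   so it ends at a Hurwitz polynomial; but its end point vanishes at p > 0.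

   Lower bounds.  First-order controllers -a (s + z) / (s + b) with b near p
   (gain) and -(s + l p) / (l s + z) with l near 1 (phase) approach these
   values.  For P and PI controllers the closed loop has degree at most 2, and
   necessary and sufficient conditions are read off its coefficients. *)

(** * Hurwitz polynomials and the continuity of roots *)

Definition hurwitz (R : realType) (f : {poly R[i]}) : Prop :=
  forall s : R[i], root f s -> complex.Re s < 0.

(** Connectedness of the unit interval in epsilon form. Let [b] be the supremum of the [t] such that
    [P] holds on [0, t]: openness of the complement gives [P b], and openness of [P] then forces
    [b = 1]. *)
Lemma clopen_unit_interval (R : realType) (P : R -> Prop) :
    P 0 ->
    (forall t, 0 <= t <= 1 -> P t -> exists2 e, 0 < e &
       forall u, 0 <= u <= 1 -> `|u - t| < e -> P u) ->
    (forall t, 0 <= t <= 1 -> ~ P t -> exists2 e, 0 < e &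
       forall u, 0 <= u <= 1 -> `|u - t| < e -> ~ P u) ->
  P 1.
Proof.
move=> P0 Popen nPopen.
pose S := [set t : R | 0 <= t <= 1 /\ forall u, 0 <= u <= t -> P u].
have S0 : S 0.
  split=> [|u hu]; first by rewrite lexx ler01.
  by have -> : u = 0 by apply/eqP; rewrite eq_le andbC.
have Sub : ubound S 1 by move=> t [/andP[]].
have hS : has_sup S by split; [exists 0 | exists 1].
have sup_ge t : S t -> t <= sup S by move=> St; apply: (ub_le_sup (proj2 hS)).
set b := sup S.
have b0 : 0 <= b by exact: sup_ge.
have b1 : b <= 1 by apply: ge_sup => //; exists 0.
have Pb u : 0 <= u -> u < b -> P u.
  move=> u0 ub; have : exists2 v, S v & u < v.
    have eb : 0 < b - u by lra.
    have [v Sv vb] := sup_adherent eb hS; exists v => //; move: vb; rewrite -/b; lra.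
  by case=> v [_ Sv] uv; apply: Sv; lra.
have PPb : P b.
  apply: contrapT => nPb.
  have [|e e0 he] := nPopen b _ nPb; first by rewrite b0.
  have [b00|b_neq0] := eqVneq b 0; first by apply: nPb; rewrite b00.
  have bp : 0 < b by rewrite lt_neqAle eq_sym b_neq0.
  pose u := Num.max 0 (b - e / 2).
  have u0 : 0 <= u by rewrite le_max lexx.
  have ub : u < b by rewrite gt_max bp; lra.
  have eu : b - e / 2 <= u by rewrite le_max lexx orbT.
  apply: (he u); [lra | | exact: Pb].
  by rewrite ltr_norml; lra.
have [->|b_neq1] := eqVneq 1 b; first exact: PPb.
have blt : b < 1 by rewrite lt_neqAle eq_sym b_neq1.
have [|e e0 he] := Popen b _ PPb; first by rewrite b0.
pose v := Num.min 1 (b + e / 2).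
have v1 : v <= 1 by rewrite ge_min lexx.
have vb : b < v by rewrite lt_min blt; lra.
have ev : v <= b + e / 2 by rewrite ge_min lexx orbT.
suff /sup_ge : S v by rewrite leNgt vb.
split=> [|u /andP[u0 uv]]; first by lra.
have [ub|ub] := ltP u b; first exact: Pb.
apply: he; first lra.
by rewrite ltr_norml; lra.
Qed.

Section Homotopy.
Local Open Scope complex_scope.
Variable R : realType.
Implicit Types (s r : R[i]) (A B f : {poly R[i]}).

(** Each factor is bounded alone: with [d = - Re r], the estimates [d <= |s - r|] and
    [1 + |s| <= |s - r| + (1 + |r|)] combine to [d * (1 + |s|) <= (1 + |r| + d) * |s - r|]. *)
Lemma norm_prod_lower_bound (rs : seq R[i]) :
    (forall r, r \in rs -> complex.Re r < 0) ->
  exists2 c : R[i], 0 < c &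
    forall s, 0 <= complex.Re s ->
      c * (1 + `|s|) ^+ size rs <= `|\prod_(r <- rs) (s - r)|.
Proof.
elim: rs => [_|r rs IH hrs].
  by exists 1 => // s _; rewrite big_nil expr0 mulr1 normr1.
have [|c c0 hc] := IH; first by move=> q qrs; apply: hrs; rewrite inE qrs orbT.
have hr : complex.Re r < 0 by apply: hrs; rewrite inE eqxx.
pose d : R[i] := (- complex.Re r)%:C.
have d0 : 0 < d by rewrite ltcR oppr_gt0.
have k0 : 0 < 1 + `|r| + d by rewrite -addrA ltr_wpDr ?addr_ge0 // ltW.
exists (d / (1 + `|r| + d) * c); first by rewrite mulr_gt0 // divr_gt0.
move=> s hs; rewrite big_cons normrM /= exprS.
rewrite [leLHS](_ : _ = (d / (1 + `|r| + d) * (1 + `|s|)) * (c * (1 + `|s|) ^+ size rs));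
  last by ring.
apply: ler_pM.
- by rewrite mulr_ge0 ?addr_ge0 // divr_ge0 // ltW.
- by rewrite mulr_ge0 ?exprn_ge0 ?addr_ge0 // ltW.
- rewrite mulrAC ler_pdivrMr //.
  have dsr : d <= `|s - r|.
    apply: le_trans (normc_ge_Re _); rewrite lecR.
    by apply: le_trans (ler_norm _);
      case: s hs {hc} => a b; case: r @d hr d0 k0 {hrs} => a' b' /=; lra.
  have h1 : 1 + `|s| <= `|s - r| + (1 + `|r|).
    rewrite addrCA lerD2l -{1}(subrK r s); exact: ler_normD.
  apply: (le_trans (ler_wpM2l (ltW d0) h1)).
  rewrite [leRHS](_ : _ = d * `|s - r| + `|s - r| * (1 + `|r|)); last by ring.
  by rewrite mulrDr lerD2l ler_wpM2r // addr_ge0.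
- exact: hc.
Qed.

Lemma norm_horner_upper_bound B n :
    (size B <= n.+1)%N ->
  exists2 c : R[i], 0 <= c & forall s, `|B.[s]| <= c * (1 + `|s|) ^+ n.
Proof.
move=> sB; exists (\sum_(i < n.+1) `|B`_i|); first by apply: sumr_ge0.
move=> s; rewrite (horner_coef_wide _ sB) mulr_suml.
apply: le_trans (ler_norm_sum _ _ _) _; apply: ler_sum => i _.
rewrite normrM normrX ler_wpM2l //.
apply: (@le_trans _ _ ((1 + `|s|) ^+ i)).
  by rewrite lerXn2r ?nnegrE ?addr_ge0 // lerDr.
by apply: ler_weXn2l; rewrite ?lerDl // -ltnS ltn_ord.
Qed.

Lemma hurwitz_neq0 f : hurwitz f -> f != 0.
Proof.
move=> hf; apply/eqP => f0.
by have := hf 0; rewrite f0 root0 /= ltxx => /(_ isT).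
Qed.

Lemma poly_factor f : f != 0 ->
  exists2 rs : seq R[i], size rs = (size f).-1 &
    forall s, f.[s] = lead_coef f * \prod_(r <- rs) (s - r).
Proof.
move=> f0; have [rs def_f] := closed_field_poly_normal f; exists rs.
  by rewrite def_f size_scale ?lead_coef_eq0 // size_prod_XsubC.
move=> s; rewrite {1}def_f hornerZ horner_prod; congr (_ * _).
by apply: eq_bigr => r _; rewrite !hornerE.
Qed.

(** On the closed right half-plane [|A|] dominates, and [|B|] is dominated by, a multiple of the
    same power of [1 + |s|]. This comparison is uniform although the half-plane is not compact, so
    [A = - t B] is impossible there for small [t]. *)
Lemma hurwitz_open A B :
    (size B < size A)%N -> hurwitz A ->
  exists2 e : R, 0 < e &
    forall t : R, `|t| < e -> hurwitz (A + t%:C *: B).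
Proof.
move=> sBA hA; have A0 := hurwitz_neq0 hA.
have [rs srs Ars] := poly_factor A0.
have [|c c0 hc] := @norm_prod_lower_bound rs.
  move=> r rrs; apply: hA; rewrite rootE Ars (big_rem r) //=.
  by rewrite subrr mul0r mulr0.
have [|k k0 hk] := @norm_horner_upper_bound B (size rs).
  by rewrite srs prednK ?size_poly_gt0 // ltnW.
have l0 : 0 < `|lead_coef A| * c by rewrite mulr_gt0 ?normr_gt0 ?lead_coef_eq0.
have k1 : 0 < k + 1 by rewrite ltr_wpDl.
have e0 : 0 < `|lead_coef A| * c / (k + 1) by rewrite divr_gt0.
(* A positive element of [R[i]] is real, so its real part can serve as the radius. *)
have eE : (complex.Re (`|lead_coef A| * c / (k + 1)))%:C = `|lead_coef A| * c / (k + 1).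
  by apply: RRe_real; rewrite gtr0_real.
exists (complex.Re (`|lead_coef A| * c / (k + 1))); first by rewrite -ltcR eE.
move=> t; rewrite -ltcR eE ltr_pdivlMr // => ht s.
rewrite rootE !hornerE addr_eq0 => /eqP Hs; rewrite ltNge; apply/negP => sge0.
have := hc s sge0; have := hk s.
set w := (1 + `|s|) ^+ _ => hkw hcw.
have w0 : 0 < w by rewrite exprn_gt0 // ltr_wpDr.
have tE : `|t%:C| = (`|t|)%:C.
  by rewrite normc_def /= expr0n addr0 sqrtr_sqr.
suff : `|A.[s]| < `|A.[s]| by rewrite ltxx.
rewrite {1}Hs normrN normrM Ars normrM tE.
apply: (@le_lt_trans _ _ ((`|t|)%:C * (k * w))).
  by rewrite ler_wpM2l // lecR.
apply: (@lt_le_trans _ _ (`|lead_coef A| * (c * w))).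
  rewrite !mulrA ltr_pM2r //; apply: le_lt_trans ht.
  by rewrite ler_wpM2l ?lecR // lerDl.
by rewrite ler_wpM2l.
Qed.

(** If [A + t B] were Hurwitz, all its roots would be at distance at least [Re s] from [s]. Then
    [|t B(s)| = |(A + t B)(s)|] would be at least [|lead_coef A|] times a fixed power of [Re s],
    which fails for small [t]. *)
Lemma nonhurwitz_open A B :
    (size B < size A)%N -> (exists2 s, root A s & 0 < complex.Re s) ->
  exists2 e : R, 0 < e &
    forall t : R, `|t| < e -> ~ hurwitz (A + t%:C *: B).
Proof.
move=> sBA [s As s0].
have A0 : A != 0 by rewrite -size_poly_gt0; apply: leq_trans sBA.
set n := (size A).-1.
have l0 : 0 < `|lead_coef A| * (complex.Re s)%:C ^+ n.
  by rewrite mulr_gt0 ?exprn_gt0 ?normr_gt0 ?lead_coef_eq0 ?ltcR.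
have k1 : 0 < `|B.[s]| + 1 by rewrite ltr_wpDl.
set e := `|lead_coef A| * (complex.Re s)%:C ^+ n / (`|B.[s]| + 1).
have e0 : 0 < e by rewrite divr_gt0.
have eE : (complex.Re e)%:C = e by apply: RRe_real; rewrite gtr0_real.
exists (complex.Re e); first by rewrite -ltcR eE.
move=> t; rewrite -ltcR eE ltr_pdivlMr // => ht hH.
have sH : (size (t%:C *: B) < size A)%N.
  by apply: leq_ltn_trans sBA; exact: size_scale_leq.
have := poly_factor (hurwitz_neq0 hH).
rewrite lead_coefDl // size_polyDl // -/n => -[rs srs Hrs].
have hrs r : r \in rs -> complex.Re r < 0.
  by move=> rrs; apply: hH; rewrite rootE Hrs (big_rem r) //= subrr mul0r mulr0.
have tE : `|t%:C| = (`|t|)%:C.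
  by rewrite normc_def /= expr0n addr0 sqrtr_sqr.
have HsE := Hrs s; rewrite !hornerE (rootP As) add0r in HsE.
have : `|lead_coef A| * (complex.Re s)%:C ^+ n <= `|t%:C * B.[s]|.
  rewrite HsE normrM ler_wpM2l // -srs => {srs Hrs HsE}.
  elim: rs hrs => [_|r rs IH hrs]; first by rewrite big_nil expr0 normr1.
  rewrite big_cons /= exprS normrM.
  have sc0 : 0 <= (complex.Re s)%:C by rewrite ler0c ltW.
  apply: ler_pM => //; first by rewrite exprn_ge0.
    apply: le_trans (normc_ge_Re _); rewrite lecR.
    have hr : complex.Re r < 0 by apply: hrs; rewrite inE eqxx.
    apply: le_trans (ler_norm _).
    by clear -hr; case: s r hr => a b [a' b'] /=; lra.
  by apply: IH => q qrs; apply: hrs; rewrite inE qrs orbT.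
move=> hle; have := lt_le_trans ht hle.
have : `|t%:C * B.[s]| <= `|t|%:C * (`|B.[s]| + 1).
  by rewrite normrM tE ler_wpM2l ?ler0c // lerDl.
by move=> /le_lt_trans/[apply]; rewrite ltxx.
Qed.

(* Roots vary continuously while the degree is constant, so they can only
   enter the closed right half-plane through the imaginary axis. *)
Lemma hurwitz_homotopy A B :
    (size B < size A)%N -> hurwitz A ->
    (forall t w : R, 0 <= t <= 1 -> ~~ root (A + t%:C *: B) (0 +i* w)) ->
  hurwitz (A + B).
Proof.
move=> sBA hA himag.
have sH t : size (A + t%:C *: B) = size A.
  by rewrite size_polyDl //; apply: leq_ltn_trans sBA; exact: size_scale_leq.
have shift t u : A + u%:C *: B = A + t%:C *: B + (u - t)%:C *: B.
  by rewrite -addrA -scalerDl -rmorphD /= [(t + _)%R]addrC subrK.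
have -> : A + B = A + 1%:C *: B by rewrite scale1r.
apply: (@clopen_unit_interval R (fun t => hurwitz (A + t%:C *: B))).
- by rewrite scale0r addr0.
- move=> t _ ht; have sz : (size B < size (A + t%:C *: B)%R)%N by rewrite sH.
  have [e e0 he] := hurwitz_open sz ht.
  by exists e => // u _ uE; rewrite (shift t u); apply: he.
- move=> t t01 nht; have sz : (size B < size (A + t%:C *: B)%R)%N by rewrite sH.
  have : exists2 s, root (A + t%:C *: B) s & 0 < complex.Re s.
    apply: contrapT => nex; apply: nht => s sroot; rewrite ltNge; apply/negP => s0.
    apply: nex; exists s => //; rewrite lt_neqAle s0 andbT; apply/negP => /eqP sE.
    have := himag t (complex.Im s) t01.
    by case: s sE sroot {s0} => a b /= <- ->.
  move=> /(nonhurwitz_open sz)[e e0 he]; exists e => // u _ uE.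
  by rewrite (shift t u); apply: he.
Qed.
End Homotopy.

(** * Stabilization expressed through a chosen representation of the controller *)

Section Stabilization.
Local Open Scope complex_scope.
Variable R : realType.
Implicit Types (NP DP NK DK d : {poly R}) (c : R[i]) (K : controller R).

Definition closed_loop NP DP c NK DK : {poly R[i]} :=
  map_poly (real_complex R) (DP * DK) + c *: map_poly (real_complex R) (NP * NK).

(** Coprimality of [NK] and [DK] is left out on purpose, so that representations with a common
    factor can be handled. *)
Definition stable_loop NP DP c NK DK : Prop :=
  [/\ (size (NP * NK)%R <= size (DP * DK)%R)%N,
      size (closed_loop NP DP c NK DK) = size (DP * DK)%R
    & hurwitz (closed_loop NP DP c NK DK)].

Lemma closed_loopM NP DP c NK DK d :
  closed_loop NP DP c (d * NK) (d * DK) =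
    map_poly (real_complex R) d * closed_loop NP DP c NK DK.
Proof.
rewrite /closed_loop (mulrCA DP) (mulrCA NP) !(rmorphM (map_poly (real_complex R))) /=.
by rewrite mulrDr -!scalerAr.
Qed.

(** This form of the degree formula also covers [f = 0], so that size comparisons can be cancelled
    arithmetically. *)
Lemma size_mull (F : idomainType) (d f : {poly F}) :
  d != 0 -> size (d * f) = ((size d).-1 * (0 < size f) + size f)%N.
Proof.
move=> d0; have [-> | f0] := eqVneq f 0; first by rewrite mulr0 size_poly0 muln0.
rewrite size_mul // size_poly_gt0 f0 muln1.
by move: d0; rewrite -size_poly_gt0; case: (size d).
Qed.

(** The common factor [d] splits off the closed loop: removing it shifts all nonzero sizes equally
    and can only remove roots. *)
Lemma stable_loop_div NP DP c NK DK d : d != 0 ->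
  stable_loop NP DP c (d * NK) (d * DK) -> stable_loop NP DP c NK DK.
Proof.
move=> d0 []; rewrite closed_loopM /stable_loop.
set f := closed_loop _ _ _ _ _.
have md0 : map_poly (real_complex R) d != 0 by rewrite map_poly_eq0.
rewrite (mulrCA DP) (mulrCA NP) !(size_mull _ d0) (size_mull _ md0) size_map_poly.
move: (size (NP * NK)) (size (DP * DK)) (size f) (size d).-1 => a b e k h1 h2 h3.
split; first by case: a b h1 {h2} => [|a] [|b]; nia.
  by case: e b h2 {h1} => [|e] [|b]; nia.
by move=> s sf; apply: h3; rewrite rootM sf orbT.
Qed.

(** By Gauss's lemma two coprime representations differ by a nonzero constant, so the pair hidden in
    [stabilizes] can be replaced by a given one. *)
Lemma stabilizes_coprime NP DP c NK DK :
    coprimep NK DK -> DK != 0 ->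
    stabilizes NP DP c (tofrac NK / tofrac DK) ->
  stable_loop NP DP c NK DK.
Proof.
move=> cop DK0 [N [D [[D0 copND E] h1 h2 h3]]].
have ND : NK * D = N * DK.
  apply/eqP; rewrite -tofrac_eq !tofracM; apply/eqP.
  by move/eqP: E; rewrite eqr_div ?tofrac_eq0 // => /eqP.
have : D %= DK.
  apply/andP; split.
    rewrite coprimep_sym in copND.
    by rewrite -(Gauss_dvdpr _ copND) -ND dvdp_mull.
  rewrite coprimep_sym in cop.
  by rewrite -(Gauss_dvdpr _ cop) ND dvdp_mull.
case/eqpf_eq=> u u0 DE.
have NE : N = u *: NK.
  by apply: (mulIf DK0); rewrite -ND DE -scalerAl scalerAr.
apply: (@stable_loop_div _ _ _ _ _ u%:P); first by rewrite polyC_eq0.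
by rewrite !mul_polyC -NE -DE.
Qed.

(** Dividing by the gcd reaches a coprime pair, so a controller may be exhibited with a cancelling
    factor. *)
Lemma stabilizes_intro NP DP c NK DK :
    DK != 0 -> stable_loop NP DP c NK DK ->
  stabilizes NP DP c (tofrac NK / tofrac DK).
Proof.
move=> DK0 hS; set d := gcdp NK DK.
have d0 : d != 0 by rewrite gcdp_eq0 negb_and DK0 orbT.
have NE : NK = d * (NK %/ d) by rewrite Pdiv.Field.divpKC ?dvdp_gcdl.
have DE : DK = d * (DK %/ d) by rewrite Pdiv.Field.divpKC ?dvdp_gcdr.
have D0 : DK %/ d != 0 by apply: contraNneq DK0; rewrite {2}DE => ->; rewrite mulr0.
have [h1 h2 h3] : stable_loop NP DP c (NK %/ d) (DK %/ d).
  by apply: (stable_loop_div d0); rewrite -NE -DE.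
exists (NK %/ d), (DK %/ d); split=> //; split=> //.
  by apply: coprimep_div_gcd; rewrite DK0 orbT.
rewrite {1}NE {1}DE !tofracM -mulf_div divff ?mul1r //.
by rewrite tofrac_eq0.
Qed.

Lemma stabilizes_rep NP DP c K : stabilizes NP DP c K ->
  exists NK DK, [/\ DK != 0, coprimep NK DK & K = tofrac NK / tofrac DK].
Proof. by case=> NK [DK [[]]]; exists NK, DK. Qed.

Lemma closed_loop_horner NP DP c NK DK s :
  (closed_loop NP DP c NK DK).[s] =
    (map_poly (real_complex R) DP).[s] * (map_poly (real_complex R) DK).[s]
    + c * ((map_poly (real_complex R) NP).[s] * (map_poly (real_complex R) NK).[s]).
Proof. by rewrite /closed_loop !rmorphM /= !hornerE. Qed.

End Stabilization.

(** * Homotopies from a closed loop to a polynomial vanishing at the unstable pole *)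

Section Obstructions.
Local Open Scope complex_scope.
Variable R : realType.
Variables p z : R.
Hypotheses (hp : 0 < p) (hz : 0 < z).
Implicit Types (NK DK : {poly R}) (c s : R[i]) (K : controller R).
Local Notation NP := ('X - z%:P : {poly R}).
Local Notation DP := ('X - p%:P : {poly R}).
Local Notation rc := (map_poly (real_complex R)).

Lemma plant_loop_horner c NK DK s :
  (closed_loop NP DP c NK DK).[s] =
    (s - p%:C) * (rc DK).[s] + c * ((s - z%:C) * (rc NK).[s]).
Proof. by rewrite closed_loop_horner !rmorphB /= !map_polyX !map_polyC /= !hornerE. Qed.

Lemma stable_loop_neq0 c NK DK s : 0 <= complex.Re s ->
  stable_loop NP DP c NK DK ->
  (s - p%:C) * (rc DK).[s] + c * ((s - z%:C) * (rc NK).[s]) != 0.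
Proof.
move=> s0 [_ _ hH]; rewrite -plant_loop_horner; apply/negP => /hH.
by rewrite ltNge s0.
Qed.

(** These sizes supply the degree hypothesis of [hurwitz_homotopy] in both obstructions. *)
Lemma stable_loop_size c NK DK : stable_loop NP DP c NK DK ->
  size (('X + z%:C%:P) * closed_loop NP DP c NK DK) = (size DK).+2 /\
  (size NK <= size DK)%N /\ (0 < size DK)%N.
Proof.
move=> [h1 h2 h3]; have cl0 := hurwitz_neq0 h3.
have DK0 : DK != 0.
  by apply: contraNneq cl0 => DK0; rewrite -size_poly_eq0 h2 DK0 mulr0 size_poly0.
have sD : size (DP * DK) = (size DK).+1.
  by rewrite size_monicM ?monicXsubC // size_XsubC.
split; first by rewrite size_monicM ?monicXaddC // size_XaddC h2 sD.
split; last by rewrite size_poly_gt0.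
have [->|NK0] := eqVneq NK 0; first by rewrite size_poly0.
by move: h1; rewrite sD size_monicM ?monicXsubC // size_XsubC.
Qed.

Lemma hurwitz_XaddM c NK DK : stable_loop NP DP c NK DK ->
  hurwitz (('X + z%:C%:P) * closed_loop NP DP c NK DK).
Proof.
move=> [_ _ h3] s; rewrite rootM => /orP[|/h3//].
rewrite rootE hornerD hornerX hornerC addr_eq0 => /eqP ->.
by rewrite /= oppr_lt0.
Qed.

Lemma horner_XaddM_addZ (a b s : R[i]) (f g : {poly R[i]}) :
  (('X + a%:P) * f + b *: g).[s] = (s + a) * f.[s] + b * g.[s].
Proof. by rewrite !hornerE. Qed.

Lemma sqr_imag (w : R) : (0 +i* w) ^+ 2 = (- w ^+ 2)%:C.
Proof. by rewrite expr2; simpc; rewrite expr2. Qed.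

Lemma imag_sub_neq0 (w : R) : (0 +i* w) - z%:C != 0.
Proof. by rewrite eq_complex /= sub0r oppr_eq0 gt_eqF. Qed.

(* On the imaginary axis, [(s - z) * (A + t B)] is, up to a nonzero real factor,
   the closed loop for the gain in the hypothesis; [A + B] vanishes at [p]. *)
Lemma gain_obstruction NK DK (mu : R) :
    (forall t w : R, 0 <= t <= 1 ->
      stable_loop NP DP (mu * (1 - t * (z ^+ 2 - p ^+ 2) / (w ^+ 2 + z ^+ 2)))%:C NK DK) ->
  False.
Proof.
move=> hst.
have hst0 : stable_loop NP DP mu%:C NK DK.
  by have := hst 0 0; rewrite lexx ler01 !mul0r subr0 mulr1 => /(_ isT).
have [sA [sNK sDK]] := stable_loop_size hst0.
pose A := ('X + z%:C%:P) * closed_loop NP DP mu%:C NK DK.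
pose B := (mu * (z ^+ 2 - p ^+ 2))%:C *: rc NK.
have hAB : hurwitz (A + B).
  apply: hurwitz_homotopy.
  - rewrite sA; apply: (@leq_ltn_trans (size NK)); last by rewrite ltnS ltnW.
    by apply: leq_trans (size_scale_leq _ _) _; rewrite size_map_poly.
  - exact: hurwitz_XaddM.
  - move=> t w t01.
    have := @stable_loop_neq0 _ NK DK (0 +i* w) _ (hst t w t01).
    rewrite lexx => /(_ isT); apply: contraNN.
    rewrite rootE scalerA horner_XaddM_addZ plant_loop_horner.
    have := sqr_imag w; have := imag_sub_neq0 w.
    set s := 0 +i* w; set d := (rc DK).[_]; set n := (rc NK).[_] => sz0 s2 /eqP E.
    have w0 : (w ^+ 2 + z ^+ 2)%:C != 0 by rewrite fmorph_eq0 gt_eqF //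
      ltr_wpDl ?sqr_ge0 ?exprn_gt0.
    (* On the axis [w ^+ 2 + z ^+ 2 = - (s - z) * (s + z)]; multiplying the closed loop by it clears
       the denominator of the gain and produces [- (s - z)] times [A + t B]. *)
    apply/eqP/(mulfI w0); rewrite mulr0 -{}[RHS](mulr0 (- (s - z%:C))) -{}E.
    move: w0; rewrite !(rmorphM, rmorphB, rmorphD, rmorphXn, fmorphV, rmorph1) /=.
    have -> : w%:C * w%:C = - (s * s).
      by rewrite -[s * s]expr2 s2 -rmorphM rmorphN opprK expr2.
    by move=> w0; field.
(* At [p] the denominator term vanishes, and [mu * (p + z) * (p - z)] cancels the coefficient of
   [B]. *)
suff /hAB/= : root (A + B) p%:C by rewrite ltNge (ltW hp).
rewrite rootE horner_XaddM_addZ plant_loop_horner; apply/eqP.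
rewrite !rmorphM !rmorphB !rmorphXn /=.
set n := _.[_]; ring.
Qed.
(** Half-angle substitution: [1 +i* x] has argument [atan x], so dividing its conjugate by it
    rotates by [- 2 * atan x]. It makes the phase factor rational. *)
Lemma expNi_atan (x : R) : expNi (2 * atan x) * (1 +i* x) = 1 -i* x.
Proof.
rewrite /expNi mulr_natl cos_mulr2n sin_mulr2n.
have c0 : cos (atan x) != 0.
  by rewrite gt_eqF // cos_gt0_pihalf // atan_gtNpi2 atan_ltpi2.
have sE : sin (atan x) = x * cos (atan x) by rewrite -{2}[x]atanK /tan divfK.
have c2 : cos (atan x) ^+ 2 * (1 + x ^+ 2) = 1.
  by rewrite mulrDr mulr1 -exprMn [cos _ * x]mulrC -sE cos2Dsin2.
rewrite sE; simpc; congr (_ +i* _); [move: c2; rewrite !expr2; lra | ring].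
Qed.

(** A convex combination of [z ^+ 2] and [z * p]; it is the [M] of the phase bound and keeps
    [w ^+ 2 + M] away from 0. *)
Lemma segment_gt0 (t : R) : 0 <= t <= 1 -> 0 < z ^+ 2 * (1 - t) + t * z * p.
Proof.
move=> /andP[t0 t1]; have [->|tn0] := eqVneq t 0.
  by rewrite subr0 mulr1 !mul0r addr0 exprn_gt0.
apply: ltr_wpDl; first by rewrite mulr_ge0 ?subr_ge0 ?sqr_ge0.
by rewrite !mulr_gt0 // lt_neqAle eq_sym tn0.
Qed.

(* As above, with [N + D = i x (N - D)] on the imaginary axis, that is
   [D + c N = 0] for [c = (1 - i x) / (1 + i x)]. *)
Lemma phase_obstruction NK DK :
    stable_loop NP DP 1 NK DK ->
    (forall t w : R, 0 <= t <= 1 ->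
      stable_loop NP DP
        (expNi (2 * atan (t * (z - p) * w / (w ^+ 2 + (z ^+ 2 * (1 - t) + t * z * p)))))
        NK DK) ->
  False.
Proof.
move=> hst0 hst.
have [sA [sNK sDK]] := stable_loop_size hst0.
pose A := ('X + z%:C%:P) * closed_loop NP DP 1 NK DK.
pose B := (z - p)%:C *: rc (('X + z%:P) * NK - DP * DK).
have BE s : (rc (('X + z%:P) * NK - DP * DK)).[s] =
    (s + z%:C) * (rc NK).[s] - (s - p%:C) * (rc DK).[s].
  by rewrite !(rmorphB, rmorphM, rmorphD) /= !map_polyX !map_polyC /= !hornerE.
have hAB : hurwitz (A + B).
  apply: hurwitz_homotopy.
  - rewrite sA ltnS; apply: leq_trans (size_scale_leq _ _) _; rewrite size_map_poly.
    apply: leq_trans (size_polyD _ _) _; rewrite geq_max size_polyN; apply/andP; split.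
      by apply: leq_trans (size_polyMleq _ _) _; rewrite size_XaddC.
    by apply: leq_trans (size_polyMleq _ _) _; rewrite size_XsubC.
  - exact: hurwitz_XaddM.
  - move=> t w t01.
    have := @stable_loop_neq0 _ NK DK (0 +i* w) _ (hst t w t01).
    rewrite lexx => /(_ isT); apply: contraNN.
    rewrite rootE scalerA horner_XaddM_addZ plant_loop_horner BE.
    have := sqr_imag w; have := imag_sub_neq0 w.
    set M := z ^+ 2 * (1 - t) + t * z * p; set x := _ / _.
    set s := 0 +i* w; set d := (rc DK).[_]; set n := (rc NK).[_] => sz0 s2 /eqP E.
    have M0 : 0 < M by exact: segment_gt0.
    have w0 : w ^+ 2 + M != 0 by rewrite gt_eqF // ltr_wpDl ?sqr_ge0.
    have xE : (0 +i* x) * (w ^+ 2 + M)%:C = (t * (z - p))%:C * s.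
      by rewrite /s; simpc; rewrite /x divfK.
    have G0 : (1 +i* x) * (w ^+ 2 + M)%:C != 0.
      by rewrite mulf_neq0 // ?fmorph_eq0 // eq_complex /= oner_eq0.
    (* With [D = (s - p) d] and [N = (s - z) n], this factor turns the closed loop into [(M - s ^+
       2) * (D + N) + t * (z - p) * s * (D - N)]. The choice of [M] makes this [- (s - z)] times
       [A + t B]. *)
    apply/eqP/(mulfI G0); rewrite mulr0.
    have cE := expNi_atan x.
    move: cE xE; have -> : 1 +i* x = 1 + 0 +i* x by simpc.
    have -> : 1 -i* x = 1 - 0 +i* x by simpc.
    move: (0 +i* x) (expNi _) => I e cE xE.
    have -> : (1 + I) * (w ^+ 2 + M)%:C * ((s - p%:C) * d + e * ((s - z%:C) * n)) =
      (w ^+ 2 + M)%:C * ((1 + I) * ((s - p%:C) * d) + e * (1 + I) * ((s - z%:C) * n)).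
      by ring.
    rewrite cE.
    have -> : (w ^+ 2 + M)%:C * ((1 + I) * ((s - p%:C) * d) + (1 - I) * ((s - z%:C) * n)) =
      (w ^+ 2 + M)%:C * ((s - p%:C) * d + (s - z%:C) * n) +
      I * (w ^+ 2 + M)%:C * ((s - p%:C) * d - (s - z%:C) * n) by ring.
    have WE : (w ^+ 2 + M)%:C = M%:C - s ^+ 2 by rewrite s2 rmorphN opprK rmorphD /= addrC.
    rewrite xE WE.
    rewrite -(mulr0 (- (s - z%:C))) -{}E /M.
    rewrite !(rmorphM, rmorphB, rmorphD, rmorphXn, rmorph1) /=.
    ring.
suff /hAB/= : root (A + B) p%:C by rewrite ltNge (ltW hp).
rewrite rootE horner_XaddM_addZ plant_loop_horner BE rmorphB; apply/eqP.
set n := _.[_]; ring.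
Qed.
End Obstructions.

(** * Upper bounds over all controllers *)

Section GeneralUpperBounds.
Local Open Scope complex_scope.
Variable R : realType.
Variables p z : R.
Hypotheses (hp : 0 < p) (hz : 0 < z).
Implicit Types (NK DK : {poly R}) (c s : R[i]) (K : controller R).
Local Notation NP := ('X - z%:P : {poly R}).
Local Notation DP := ('X - p%:P : {poly R}).
Local Notation rc := (map_poly (real_complex R)).

(** The pair inside [stabilizes] may depend on [c]; the homotopies need a single pair for the whole
    range. *)
Lemma stabilizes_fixed_rep (N D : {poly R}) c0 K : stabilizes N D c0 K ->
  exists NK DK, forall c, stabilizes N D c K -> stable_loop N D c NK DK.
Proof.
move=> /stabilizes_rep[NK [DK [DK0 cop ->]]]; exists NK, DK => c.
exact: stabilizes_coprime.
Qed.

Definition P_gain_bound : R := Num.max (p / z) (z / p).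
Definition P_phase_bound : R := atan (`|z - p| / (2 * Num.sqrt (p * z))).

(** The gains met in [gain_obstruction] lie between its [mu] and [mu * (p / z) ^+ 2]. Starting from
    [(z / p) ^+ 2] when [p < z], and from 1 otherwise, keeps them in [1, r^2], with r =
    [P_gain_bound]. *)
Lemma gain_upper K mu :
    (forall alpha, 1 <= alpha -> alpha < mu -> stabilizes NP DP alpha%:C K) ->
  mu <= P_gain_bound ^+ 2.
Proof.
move=> hK; rewrite leNgt; apply/negP => hmu.
have r1 : 1 <= P_gain_bound.
  rewrite /P_gain_bound le_max !ler_pdivlMr // !mul1r; exact: le_total.
have [|NK [DK hst]] := @stabilizes_fixed_rep NP DP 1%:C K.
  by apply: hK => //; apply: le_lt_trans hmu; rewrite exprn_ege1.
have {hK} hst a : 1 <= a -> a <= P_gain_bound ^+ 2 -> stable_loop NP DP a%:C NK DK.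
  by move=> a1 a2; apply/hst/hK => //; apply: le_lt_trans hmu.
have [pz|zp] := ltP p z.
- apply: (@gain_obstruction R p z hp hz NK DK ((z / p) ^+ 2)) => t w /andP[t0 t1].
  have rE : P_gain_bound = z / p.
    by apply/max_idPr; rewrite ler_pdivrMr // mulrAC
      ler_pdivlMr // -!expr2 ler_pXn2r ?nnegrE ?(ltW hp) ?(ltW hz) ?(ltW pz) //.
  set q := t * _ / _.
  have wz : 0 < w ^+ 2 + z ^+ 2 by rewrite ltr_wpDl ?sqr_ge0 ?exprn_gt0.
  have q0 : 0 <= q.
    apply: divr_ge0; last exact: ltW.
    by rewrite mulr_ge0 // subr_ge0 ler_pXn2r ?nnegrE ?(ltW hp) ?(ltW hz) ?(ltW pz).
  have q1 : q <= 1 - (p / z) ^+ 2.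
    rewrite ler_pdivrMr // -(ler_pM2r (exprn_gt0 2 hz)).
    have -> : (1 - (p / z) ^+ 2) * (w ^+ 2 + z ^+ 2) * z ^+ 2 =
        (z ^+ 2 - p ^+ 2) * (w ^+ 2 + z ^+ 2).
      by field; rewrite gt_eqF.
    have D0 : 0 <= z ^+ 2 - p ^+ 2 by rewrite subr_ge0 ler_pXn2r ?nnegrE ?(ltW hp) ?(ltW hz) ?(ltW pz).
    rewrite [leLHS](_ : _ = (z ^+ 2 - p ^+ 2) * (t * z ^+ 2)); last by ring.
    rewrite ler_wpM2l //; apply: (@le_trans _ _ (z ^+ 2)); last by rewrite lerDr sqr_ge0.
    by rewrite ler_piMl ?sqr_ge0.
  have k0 : 0 < (z / p) ^+ 2 by rewrite exprn_gt0 ?divr_gt0.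
  apply: hst; last by rewrite rE ger_pMr //; lra.
  rewrite [leLHS](_ : 1 = (z / p) ^+ 2 * (p / z) ^+ 2); last by field; rewrite !gt_eqF.
  by rewrite ler_pM2l //; lra.
- apply: (@gain_obstruction R p z hp hz NK DK 1) => t w /andP[t0 t1].
  have rE : P_gain_bound = p / z.
    by apply/max_idPl; rewrite ler_pdivrMr // mulrAC
      ler_pdivlMr // -!expr2 ler_pXn2r ?nnegrE ?(ltW hp) ?(ltW hz).
  have wz : 0 < w ^+ 2 + z ^+ 2 by rewrite ltr_wpDl ?sqr_ge0 ?exprn_gt0.
  have D0 : 0 <= p ^+ 2 - z ^+ 2 by rewrite subr_ge0 ler_pXn2r ?nnegrE ?(ltW hp) ?(ltW hz).
  rewrite mul1r -[z ^+ 2 - _]opprB mulrN mulNr opprK.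
  set q := t * _ / _.
  have q0 : 0 <= q by apply: divr_ge0; [rewrite mulr_ge0 | exact: ltW].
  have q1 : q <= (p / z) ^+ 2 - 1.
    rewrite ler_pdivrMr // -(ler_pM2r (exprn_gt0 2 hz)).
    have -> : ((p / z) ^+ 2 - 1) * (w ^+ 2 + z ^+ 2) * z ^+ 2 =
        (p ^+ 2 - z ^+ 2) * (w ^+ 2 + z ^+ 2).
      by field; rewrite gt_eqF.
    rewrite [leLHS](_ : _ = (p ^+ 2 - z ^+ 2) * (t * z ^+ 2)); last by ring.
    rewrite ler_wpM2l //; apply: (@le_trans _ _ (z ^+ 2)); last by rewrite lerDr sqr_ge0.
    by rewrite ler_piMl ?sqr_ge0.
  by apply: hst; rewrite ?rE; lra.
Qed.

(** The angles met in [phase_obstruction] are at most [2 * P_phase_bound] in absolute value. Indeed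
    [M >= t ^+ 2 * m ^+ 2], whence [w ^+ 2 + M >= 2 * t * m * |w|] by the inequality of arithmetic
    and geometric means. *)
Lemma phase_upper K eta :
    (forall theta, - eta < theta -> theta < eta -> stabilizes NP DP (expNi theta) K) ->
  eta <= 2 * P_phase_bound.
Proof.
move=> hK; rewrite leNgt; apply/negP => heta.
have m0 : 0 < 2 * Num.sqrt (p * z) by rewrite mulr_gt0 // sqrtr_gt0 mulr_gt0.
have a0 : 0 <= P_phase_bound.
  by rewrite /P_phase_bound -atan0 le_atan // divr_ge0 // ltW.
have e0 : expNi 0 = 1 :> R[i] by rewrite /expNi cos0 sin0 oppr0.
have [|NK [DK hst]] := @stabilizes_fixed_rep NP DP (expNi 0) K.
  by apply: hK; lra.
apply: (@phase_obstruction R p z hp hz NK DK).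
  by rewrite -e0; apply/hst/hK; lra.
move=> t w /andP[t0 t1]; apply/hst.
set x := t * _ * _ / _.
suff /andP[x1 x2] : - P_phase_bound <= atan x <= P_phase_bound by apply: hK; lra.
rewrite /P_phase_bound -atanN -[_ && _]/(_ <= _ <= _).
set k := _ / (2 * _).
suff : `|x| <= k by rewrite ler_norml => /andP[? ?]; rewrite !le_atan.
set m := Num.sqrt (p * z) in m0 k *.
have m2 : m ^+ 2 = p * z by rewrite sqr_sqrtr // mulr_ge0 // ltW.
set M := z ^+ 2 * (1 - t) + t * z * p in x *.
have hM : t ^+ 2 * m ^+ 2 <= M.
  rewrite m2 -subr_ge0 /M.
  have -> : z ^+ 2 * (1 - t) + t * z * p - t ^+ 2 * (p * z) =
     z ^+ 2 * (1 - t) + (p * z) * (t * (1 - t)) by ring.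
  by rewrite addr_ge0 ?mulr_ge0 ?subr_ge0 ?sqr_ge0 ?(ltW hp) ?(ltW hz).
have M0 : 0 < w ^+ 2 + M.
  by rewrite ltr_wpDl ?sqr_ge0 // segment_gt0 // t0 t1.
rewrite /x normrM normfV (gtr0_norm M0) ler_pdivrMr // /k [leRHS]mulrAC ler_pdivlMr //.
rewrite !normrM (ger0_norm t0) [t * _]mulrC -!mulrA ler_wpM2l //.
apply: le_trans (lerD (lexx _) hM); rewrite -[w ^+ 2]real_normK ?num_real //.
by have := sqr_ge0 (`|w| - t * m); nra.
Qed.

(** For [f = l (s - r1) (s - r2)] the two real parts are [- |l|^2 Re (r1 + r2)] and
    [- |l|^2 (|r1|^2 Re r2 + |r2|^2 Re r1)]. *)
Lemma hurwitz_quadratic (f : {poly R[i]}) (a b c : R[i]) :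
    (forall s, f.[s] = a * s ^+ 2 + b * s + c) -> size f = 3%N -> hurwitz f ->
  0 < complex.Re (b * a^*) /\ 0 < complex.Re (b * c^*).
Proof.
move=> fE sf hf; have f0 := hurwitz_neq0 hf.
have [[|r1 [|r2 []]]] := poly_factor f0; rewrite ?sf // => _ Hf.
have hr1 : complex.Re r1 < 0.
  by apply: hf; rewrite rootE Hf !big_cons subrr mul0r mulr0.
have hr2 : complex.Re r2 < 0.
  by apply: hf; rewrite rootE Hf !big_cons subrr mul0r !mulr0.
have l0 : lead_coef f != 0 by rewrite lead_coef_eq0.
move: (lead_coef f) l0 Hf => l l0 Hf.
have HE s : a * s ^+ 2 + b * s + c = l * ((s - r1) * (s - r2)).
  by rewrite -fE Hf !big_cons big_nil mulr1.
have n2 : 2 != 0 :> R[i] by rewrite pnatr_eq0.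
(* The coefficients are recovered from the values at 0, 1 and -1. *)
have cE : c = l * (r1 * r2) by have := HE 0; rewrite expr0n /= !mulr0 !add0r mulrNN.
have bE : b = - l * (r1 + r2).
  apply: (mulfI n2); have := congr2 (fun x y => x - y) (HE 1) (HE (-1)).
  rewrite cE => E; transitivity (a * 1 ^+ 2 + b * 1 + c - (a * (-1) ^+ 2 + b * -1 + c));
    first by ring.
  by rewrite cE E; ring.
have aE : a = l.
  have E := HE 1; rewrite cE bE in E.
  transitivity (a * 1 ^+ 2 + - l * (r1 + r2) * 1 + l * (r1 * r2) + l * (r1 + r2) - l * (r1 * r2)).
    by ring.
  by rewrite E; ring.
rewrite {HE fE}aE bE cE.
case: l l0 r1 hr1 r2 hr2 {Hf cE bE} => u v; rewrite eq_complex /= => uv [x1 y1] /= hx1 [x2 y2] /= hx2.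
have n0 : 0 < u ^+ 2 + v ^+ 2.
  rewrite lt_neqAle addr_ge0 ?sqr_ge0 // andbT eq_sym paddr_eq0 ?sqr_ge0 //.
  by rewrite !sqrf_eq0.
split.
  rewrite [ltRHS](_ : _ = (u ^+ 2 + v ^+ 2) * (- (x1 + x2))); last by simpc => /=; ring.
  by rewrite mulr_gt0 //; lra.
rewrite [ltRHS](_ : _ = (u ^+ 2 + v ^+ 2) *
    ((x1 ^+ 2 + y1 ^+ 2) * (- x2) + (x2 ^+ 2 + y2 ^+ 2) * (- x1)));
  last by simpc => /=; ring.
rewrite mulr_gt0 // ltr_wpDr ?mulr_ge0 ?addr_ge0 ?sqr_ge0 ?oppr_ge0 ?ltW //.
by rewrite mulr_gt0 ?oppr_gt0 // ltr_wpDr ?sqr_ge0 // exprn_even_gt0 //= lt_eqF.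
Qed.
End GeneralUpperBounds.

(** * Upper bounds for PI controllers *)

Section PIControllers.
Local Open Scope complex_scope.
Variable R : realType.
Variables p z : R.
Hypotheses (hp : 0 < p) (hz : 0 < z).
Local Notation NP := ('X - z%:P : {poly R}).
Local Notation DP := ('X - p%:P : {poly R}).
Local Notation PI kp ki := (tofrac kp%:P + tofrac ki%:P / tofrac 'X : controller R).

(** For [ki != 0] the closed loop is quadratic and [hurwitz_quadratic] applies. For [ki = 0] the
    integrator cancels and a linear polynomial remains, hence the disjunction. *)
Lemma PI_necessary (c : R[i]) (kp ki : R) : stabilizes NP DP c (PI kp ki) ->
  0 < complex.Re ((- p%:C + c * (ki - z * kp)%:C) * (1 + c * kp%:C)^*) /\
  (ki = 0 \/
   0 < complex.Re ((- p%:C + c * (ki - z * kp)%:C) * (- c * (z * ki)%:C)^*)).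
Proof.
have [->|ki0] := eqVneq ki 0.
  rewrite rmorph0 mul0r addr0 sub0r -[tofrac _]divr1 -tofrac1.
  move=> /stabilizes_coprime[]; rewrite ?coprimep1 ?oner_neq0 // mulr1 size_XsubC.
  move=> _; set f := closed_loop _ _ _ _ _; set a2 := 1 + _; set a1 := - _ + _.
  have fE : f = a2 *: 'X + a1%:P.
    rewrite /f /closed_loop mulr1 !(rmorphM, rmorphB) /= !map_polyX !map_polyC /=.
    rewrite -!mul_polyC /a2 /a1 !(rmorphM, rmorphD, rmorphN, rmorph1) /=; ring.
  move=> sf hf; split; last by left.
  have a20 : a2 != 0.
    apply/negP => /eqP a20; have := size_polyC_leq1 a1.
    by rewrite -[a1%:P]add0r -[X in X + _](scale0r 'X) -a20 -fE sf.
  have : root f (- a1 / a2).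
    by rewrite rootE fE hornerD hornerZ hornerX hornerC mulrCA divff // mulr1 addNr.
  move=> /hf.
  have -> : a1 * a2^* = - (- a1 / a2) * (a2 * a2^*) by field.
  move: (- a1 / a2) => [x y] /= x0.
  case: (a2) a20 => u v; rewrite eq_complex /= => uv; simpc => /=.
  have n0 : 0 < u ^+ 2 + v ^+ 2.
    rewrite lt_neqAle addr_ge0 ?sqr_ge0 // andbT eq_sym paddr_eq0 ?sqr_ge0 //.
    by rewrite !sqrf_eq0.
  rewrite [ltRHS](_ : _ = (u ^+ 2 + v ^+ 2) * (- x)); last by ring.
  by rewrite mulr_gt0 ?oppr_gt0.
have -> : PI kp ki = tofrac (kp *: 'X + ki%:P) / tofrac 'X.
  by rewrite -mul_polyC tofracD tofracM mulrDl mulfK // tofrac_eq0 polyX_eq0.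
move=> /stabilizes_coprime[].
- rewrite coprimep_sym; apply/Bezout_coprimepP.
  exists (- (kp / ki)%:P, (ki^-1)%:P) => /=.
  rewrite -mul_polyC.
  suff -> : - (kp / ki)%:P * 'X + ki^-1%:P * (kp%:P * 'X + ki%:P) = 1 :> {poly R} by exact: eqpxx.
  have : ki^-1%:P * ki%:P = 1 :> {poly R} by rewrite -polyCM mulVf.
  rewrite polyCM => E; transitivity (ki^-1%:P * ki%:P : {poly R}); [ring | exact: E].
- by rewrite polyX_eq0.
have -> : size (DP * 'X) = 3%N by rewrite size_mulX ?size_XsubC ?polyXsubC_eq0.
move=> _ sf hf; have [] := hurwitz_quadratic (a := 1 + c * kp%:C)
  (b := - p%:C + c * (ki - z * kp)%:C) (c := - c * (z * ki)%:C) _ sf hf.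
  move=> s; rewrite plant_loop_horner rmorphD /= map_polyZ /= !map_polyX map_polyC /=.
  rewrite hornerD hornerZ hornerX hornerC.
  rewrite !(rmorphB, rmorphM) /=; ring.
by move=> h1 h2; split=> //; right.
Qed.
(** Integral action brings no gain: a nonzero [alpha * ki] has the sign opposite to the middle
    coefficient, hence to [1 + x] with [x = alpha * kp]. Subtracting it shows that [- (p + z * x)]
    has the sign of [1 + x], as for a static gain. *)
Lemma PI_gain_necessary (alpha kp ki : R) :
    stabilizes NP DP alpha%:C (PI kp ki) ->
  (1 + alpha * kp) * (p + z * (alpha * kp)) < 0.
Proof.
move=> /PI_necessary; simpc => /= -[h1 h2].
set x := alpha * kp in h1 h2 *.
have h3 : ki = 0 \/ 0 < (- p + alpha * (ki - z * kp)) * - (alpha * ki).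
  case: h2 => [->|h2]; [by left | right].
  by rewrite -(pmulr_rgt0 _ hz); move: h2;
    rewrite [X in 0 < X -> _](_ : _ = z * ((- p + alpha * (ki - z * kp)) * - (alpha * ki))) //; ring.
have E : - p + alpha * (ki - z * kp) = - (p + z * x) + alpha * ki by rewrite /x; ring.
rewrite {}E in h1 h3.
case: h3 => [k0|h3]; first by move: h1; rewrite k0; nra.
move: (alpha * ki) h1 h3 => y h1 h3.
have [xp|xn] := ltP 0 (1 + x).
  have b0 : 0 < - (p + z * x) + y by rewrite -(pmulr_lgt0 _ xp).
  have y0 : y < 0 by move: h3; rewrite pmulr_rgt0 // oppr_gt0.
  by rewrite pmulr_rlt0 //; lra.
have b0 : - (p + z * x) + y < 0.
  by rewrite ltNge; apply/negP => b0; have := mulr_ge0_le0 b0 xn; rewrite leNgt h1.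
have y0 : 0 < y by move: h3; rewrite nmulr_rgt0 // oppr_lt0.
have xn' : 1 + x < 0.
  by rewrite lt_neqAle xn andbT; apply/eqP => x0; move: h1; rewrite x0 mulr0 ltxx.
by rewrite nmulr_rlt0 //; lra.
Qed.

(** The condition at [theta] bounds the left side strictly by [ki * (kp + cos theta)], so it
    suffices that this product is nonpositive. If [ki > 0], the conditions at angle 0 give
    [kp < -1]. If [ki < 0] and [kp + cos theta < 0], the two conditions at [theta] contradict each
    other. *)
Lemma PI_phase_necessary (theta kp ki : R) :
    stabilizes NP DP (expNi 0) (PI kp ki) ->
    stabilizes NP DP (expNi theta) (PI kp ki) ->
  p + z * kp ^+ 2 + (p + z) * kp * cos theta < 0.
Proof.
move=> /PI_necessary h0 /PI_necessary ht.
have C1 := cos_le1 theta; have C2 := cos_geN1 theta; have CS := cos2Dsin2 theta.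
move: h0 ht; rewrite /expNi cos0 sin0; simpc => /=.
move: (cos theta) (sin theta) C1 C2 CS => C S C1 C2 CS.
move=> [h1 h2] [h3 h4].
have {}h3 : 0 < - p + kp * (ki - z * kp) + C * (ki - z * kp - p * kp).
  suff <- : (- p + C * (ki - z * kp)) * (1 + C * kp) + S * (ki - z * kp) * (S * kp) =
      - p + kp * (ki - z * kp) + C * (ki - z * kp - p * kp) by move: h3; lra.
  have -> : - p + kp * (ki - z * kp) + C * (ki - z * kp - p * kp) =
    - p + (C ^+ 2 + S ^+ 2) * kp * (ki - z * kp) + C * (ki - z * kp - p * kp).
    by rewrite CS; ring.
  ring.
have [k0|k0] := eqVneq ki 0; first by move: h3; rewrite k0; nra.
case: h2 h4 => [/eqP|h2]; first by rewrite (negbTE k0).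
case=> [/eqP|h4]; first by rewrite (negbTE k0).
have {}h4 : 0 < - ki * (- p * C + ki - z * kp).
  rewrite -(pmulr_rgt0 _ hz).
  suff <- : (- p + C * (ki - z * kp)) * (- C * (z * ki)) + S * (ki - z * kp) * - (S * (z * ki)) =
     z * (- ki * (- p * C + ki - z * kp)) by move: h4; lra.
  have -> : z * (- ki * (- p * C + ki - z * kp)) =
     z * (- ki * (- p * C + (C ^+ 2 + S ^+ 2) * (ki - z * kp))).
    by rewrite CS; ring.
  ring.
have {}h2 : 0 < - ki * (- p + ki - z * kp).
  by rewrite -(pmulr_rgt0 _ hz); move: h2; lra.
have {}h1 : 0 < (- p + ki - z * kp) * (1 + kp) by move: h1; lra.
have [kin|kip] := ltP ki 0.
  have a0 : 0 < - p + ki - z * kp by move: h2; rewrite pmulr_rgt0 // oppr_gt0.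
  have b0 : 0 < - p * C + ki - z * kp by move: h4; rewrite pmulr_rgt0 // oppr_gt0.
  have [kC|kC] := leP (- kp) C.
    have : 0 <= - ki * (kp + C) by rewrite mulr_ge0 //; lra.
    by move: h3; lra.
  have : 0 < (- kp - C) * (- p * C + ki - z * kp) by rewrite mulr_gt0 //; lra.
  have : 0 <= p * (1 - C ^+ 2) by rewrite mulr_ge0 ?(ltW hp) // subr_ge0 -CS lerDl sqr_ge0.
  by move: h3; lra.
have ki_gt0 : 0 < ki by rewrite lt_neqAle eq_sym k0.
have a0 : - p + ki - z * kp < 0 by move: h2; rewrite nmulr_rgt0 // oppr_lt0.
have b0 : 1 + kp < 0 by move: h1; rewrite nmulr_rgt0.
have : 0 <= ki * (- kp - C) by rewrite mulr_ge0 //; lra.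
by move: h3; lra.
Qed.

Local Notation ratio_bound := (P_gain_bound p z).
Local Notation angle_bound := (P_phase_bound p z).

Lemma ratio_bound_ge1 : 1 <= ratio_bound.
Proof.
by rewrite /ratio_bound le_max !ler_pdivlMr // !mul1r; exact: le_total.
Qed.

(** [PI_gain_necessary] confines [alpha * kp] strictly between [-1] and [- p / z]. The larger of
    these endpoints in absolute value is [ratio_bound] times the smaller, so multiplying by
    [ratio_bound] leaves the interval. *)
Lemma PI_gain_upper kp ki mu :
    (forall alpha, 1 <= alpha -> alpha < mu -> stabilizes NP DP alpha%:C (PI kp ki)) ->
  mu <= ratio_bound.
Proof.
move=> hK; rewrite leNgt; apply/negP => hmu.
have r1 := ratio_bound_ge1.
have h1 : (1 + kp) * (p + z * kp) < 0.
  have := @PI_gain_necessary 1 kp ki; rewrite mul1r; apply; apply: hK => //.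
  exact: le_lt_trans hmu.
have hr : (1 + ratio_bound * kp) * (p + z * (ratio_bound * kp)) < 0.
  exact/PI_gain_necessary/hK.
have r2 : p <= ratio_bound * z by rewrite -ler_pdivrMr // /ratio_bound le_max lexx.
have r3 : z <= ratio_bound * p by rewrite -ler_pdivrMr // /ratio_bound le_max lexx orbT.
move: (ratio_bound) r1 r2 r3 hr => r r1 r2 r3 hr.
have k0 : kp < 0.
  rewrite ltNge; apply/negP => k0; move: h1; rewrite ltNge => /negP; apply.
  by rewrite mulr_ge0 ?addr_ge0 ?mulr_ge0 ?(ltW hp) ?(ltW hz).
have rk : r * kp <= kp by rewrite ger_nMl.
suff [a b] : 1 + r * kp <= 0 /\ p + z * (r * kp) <= 0.
  by move: hr; rewrite ltNge mulr_le0.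
have [ks|kb] := ltP (-1) kp.
  have a : p + z * kp < 0 by move: h1; rewrite pmulr_rlt0 //; lra.
  have zrk : z * (r * kp) <= z * kp by rewrite ler_wpM2l // ltW.
  split; last by lra.
  have b : r * (p + z * kp) <= 0 by rewrite mulr_ge0_le0 //; lra.
  by rewrite -(pmulr_rle0 _ hz); move: b r3; lra.
split; first by lra.
have : r * z * (1 + kp) <= 0 by rewrite mulr_ge0_le0 ?mulr_ge0 ?(ltW hz) //; lra.
by move: r2; lra.
Qed.

Lemma cos_angle_bound : cos angle_bound = 2 * Num.sqrt (p * z) / (p + z).
Proof.
have m0 : 0 < Num.sqrt (p * z) by rewrite sqrtr_gt0 mulr_gt0.
have m2 : Num.sqrt (p * z) ^+ 2 = p * z by rewrite sqr_sqrtr // mulr_ge0 // ltW.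
rewrite cos_atan; set m := Num.sqrt (p * z) in m0 m2 *.
have -> : 1 + (`|z - p| / (2 * m)) ^+ 2 = ((p + z) / (2 * m)) ^+ 2.
  rewrite !expr_div_n real_normK ?num_real //.
  rewrite -[X in X + _](@divff _ ((2 * m) ^+ 2)) ?expf_neq0 ?gt_eqF ?mulr_gt0 //.
  by rewrite -mulrDl exprMn m2; congr (_ / _); ring.
by rewrite sqrtr_sqr gtr0_norm ?invf_div // divr_gt0 ?addr_gt0 ?mulr_gt0.
Qed.

Lemma angle_bound_ge0 : 0 <= angle_bound.
Proof.
by rewrite /P_phase_bound -[leLHS](@atan0 R) le_atan // divr_ge0 // mulr_ge0 ?sqrtr_ge0.
Qed.

(** At [theta = angle_bound] the necessary condition would make the square of [sqrt p + sqrt z * kp]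
    negative. *)
Lemma PI_phase_upper kp ki eta :
    (forall theta, - eta < theta -> theta < eta -> stabilizes NP DP (expNi theta) (PI kp ki)) ->
  eta <= angle_bound.
Proof.
move=> hK; rewrite leNgt; apply/negP => heta.
have a0 := angle_bound_ge0.
have : p + z * kp ^+ 2 + (p + z) * kp * cos angle_bound < 0.
  by apply: PI_phase_necessary; apply: hK; lra.
rewrite cos_angle_bound [X in _ + X](_ : _ = 2 * Num.sqrt (p * z) * kp);
  last by field; rewrite gt_eqF ?addr_gt0.
rewrite sqrtrM ?ltW // ltNge => /negP; apply.
rewrite -{1}(sqr_sqrtr (ltW hp)) -{1}(sqr_sqrtr (ltW hz)).
have := sqr_ge0 (Num.sqrt p + Num.sqrt z * kp); lra.
Qed.
End PIControllers.

(** * Proportional controllers attaining or approaching the bounds *)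

Section PLowerBounds.
Local Open Scope complex_scope.
Variable R : realType.
Variables p z : R.
Hypotheses (hp : 0 < p) (hz : 0 < z).
Local Notation NP := ('X - z%:P : {poly R}).
Local Notation DP := ('X - p%:P : {poly R}).
Local Notation ratio_bound := (P_gain_bound p z).
Local Notation angle_bound := (P_phase_bound p z).

Lemma size_lin (F : nzRingType) (a b : F) : a != 0 -> size (a *: 'X + b%:P) = 2%N.
Proof.
move=> a0; rewrite -mul_polyC size_MXaddC size_polyC polyC_eq0 a0 /=.
by rewrite (negbTE a0).
Qed.

(** The two nonvanishing conditions fix the degrees of [DP * DK] and of the closed loop at 2,
    leaving only the location of the roots. *)
Lemma stabilizes_first_order (c : R[i]) (n1 n0 d1 d0 : R) :
    d1 != 0 -> d1%:C + c * n1%:C != 0 ->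
    (forall s : R[i], (s - p%:C) * (d1%:C * s + d0%:C)
       + c * ((s - z%:C) * (n1%:C * s + n0%:C)) = 0 -> complex.Re s < 0) ->
  stabilizes NP DP c (tofrac (n1 *: 'X + n0%:P) / tofrac (d1 *: 'X + d0%:P)).
Proof.
move=> d10 a20 hs.
have sD : size (d1 *: 'X + d0%:P) = 2%N by exact: size_lin.
have sDD : size (DP * (d1 *: 'X + d0%:P)) = 3%N.
  rewrite size_monicM ?monicXsubC ?size_XsubC ?sD //.
  by rewrite -size_poly_eq0 sD.
apply: stabilizes_intro; first by rewrite -size_poly_eq0 sD.
set NK := n1 *: 'X + _ in hs *; set DK := d1 *: 'X + _ in sD sDD hs *.
have fs s : (closed_loop NP DP c NK DK).[s] = (s - p%:C) * (d1%:C * s + d0%:C)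
       + c * ((s - z%:C) * (n1%:C * s + n0%:C)).
  rewrite plant_loop_horner !rmorphD /= !map_polyZ /= !map_polyX !map_polyC /=.
  by rewrite !hornerD !hornerZ hornerX !hornerC.
split.
- rewrite sDD; apply: leq_trans (size_polyMleq _ _) _; rewrite size_XsubC /=.
  rewrite ltnS /NK -mul_polyC size_MXaddC; case: ifP => // _.
  by rewrite ltnS size_polyC_leq1.
- rewrite sDD; set f := closed_loop _ _ _ _ _.
  pose a1 := (d0 - p * d1)%:C + c * (n0 - z * n1)%:C.
  pose a0 := - (p * d0)%:C - c * (z * n0)%:C.
  have -> : f = (d1%:C + c * n1%:C) *: 'X^2 + (a1%:P * 'X + a0%:P).
    rewrite /f /closed_loop /DK /NK !(rmorphM, rmorphB, rmorphD) /= !map_polyZ /= !map_polyX !map_polyC /=.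
    rewrite -!mul_polyC /a1 /a0 !(rmorphM, rmorphD, rmorphN) /=; ring.
  rewrite size_polyDl size_scale // size_polyXn // ltnS size_MXaddC.
  by case: ifP => // _; rewrite ltnS size_polyC_leq1.
by move=> s; rewrite rootE fs => /eqP /hs.
Qed.

(* Lets a static gain be treated as a first-order controller, at the price of a
   cancelling pole at [-1]. *)
Lemma tofrac_static (k : R) :
  tofrac k%:P = tofrac (k *: 'X + k%:P) / tofrac (1 *: 'X + 1%:P) :> controller R.
Proof.
have -> : k *: 'X + k%:P = k%:P * (1 *: 'X + 1%:P) :> {poly R}.
  by rewrite scale1r mulrDr mulr1 mul_polyC.
rewrite tofracM mulfK // tofrac_eq0 -size_poly_eq0 size_lin //.
Qed.

Lemma Re_lt0_div (a b s : R[i]) : a * s = b -> complex.Re (b * a^*) < 0 ->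
  complex.Re s < 0.
Proof.
move=> <-; case: a s => u v [x y] h.
have {h} : (u ^+ 2 + v ^+ 2) * x < 0 by move: h; simpc => /=; lra.
have n0 : 0 <= u ^+ 2 + v ^+ 2 by rewrite addr_ge0 ?sqr_ge0.
by rewrite /=; nra.
Qed.

(** Apart from the artificial factor [s + 1] the closed loop is linear. The strict inequality places
    its root and also excludes [1 + c * k = 0]. *)
Lemma P_sufficient (c : R[i]) (k : R) :
    complex.Re ((p%:C + c * (z * k)%:C) * (1 + c * k%:C)^*) < 0 ->
  stabilizes NP DP c (tofrac k%:P).
Proof.
move=> h; rewrite tofrac_static; apply: stabilizes_first_order.
- exact: oner_neq0.
- rewrite rmorph1; apply: contraTneq h => ->.
  by case: (p%:C + _) => u v /=; rewrite oppr0 !mulr0 subrr ltxx.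
move=> s; have -> : (s - p%:C) * (1%:C * s + 1%:C) + c * ((s - z%:C) * (k%:C * s + k%:C)) =
   (s + 1) * ((1 + c * k%:C) * s - (p%:C + c * (z * k)%:C)).
  by rewrite rmorphM rmorph1; ring.
move=> /eqP; rewrite mulf_eq0 => /orP[|].
  by rewrite addr_eq0 => /eqP -> /=; rewrite ltrN10.
by rewrite subr_eq0 => /eqP /Re_lt0_div; apply.
Qed.

(** The product [alpha * k] must stay strictly between [-1] and [- p / z]. With [y'] midway between
    [y] and the bound, [k] is the endpoint of larger absolute value divided by [y']. *)
Lemma P_gain_lower y : y < ratio_bound ->
  exists k : R, forall alpha, 1 <= alpha -> alpha < y -> stabilizes NP DP alpha%:C (tofrac k%:P).
Proof.
move=> yr.
have suff_real alpha k : (1 + alpha * k) * (p + z * (alpha * k)) < 0 ->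
    stabilizes NP DP alpha%:C (tofrac k%:P).
  by move=> h; apply: P_sufficient; simpc => /=; move: h; lra.
have [y1|y1] := leP y 1.
  by exists 0 => alpha a1 a2; move: (le_lt_trans a1 a2); rewrite ltNge y1.
have [pz|zp] := ltP p z.
  have {}yr : y < z / p.
    move: yr; rewrite /P_gain_bound lt_max => /orP[|//].
    have : p / z < 1 by rewrite ltr_pdivrMr // mul1r.
    by move=> h1 h2; move: y1 (lt_trans h2 h1); lra.
  pose y' := (y + z / p) / 2.
  have yy : y < y' by rewrite /y'; lra.
  have y0 : 0 < y' by lra.
  have yp : y' * p < z by rewrite -ltr_pdivlMr // /y'; lra.
  exists (- y'^-1) => alpha a1 a2; apply: suff_real.
  rewrite mulrN -[alpha / y']/(alpha / y').
  have b1 : alpha / y' < 1 by rewrite ltr_pdivrMr //; lra.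
  have b2 : p < z * (alpha / y').
    rewrite mulrA ltr_pdivlMr // mulrC (lt_le_trans yp) // ler_peMr // ltW //.
  by rewrite pmulr_rlt0; lra.
have {}yr : y < p / z.
  move: yr; rewrite /P_gain_bound lt_max => /orP[//|].
  have : z / p <= 1 by rewrite ler_pdivrMr // mul1r.
  by move=> h1 h2; move: y1 (lt_le_trans h2 h1); lra.
pose y' := (y + p / z) / 2.
have yy : y < y' by rewrite /y'; lra.
have y0 : 0 < y' by lra.
have yp : y' * z < p by rewrite -ltr_pdivlMr // /y'; lra.
exists (- (p / (z * y'))) => alpha a1 a2; apply: suff_real.
have b1 : 1 < alpha * (p / (z * y')).
  have zy : 0 < z * y' by rewrite mulr_gt0.
  rewrite mulrA ltr_pdivlMr // mul1r [z * _]mulrC (lt_le_trans yp) // ler_peMl // ltW //.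
have b2 : z * (alpha * (p / (z * y'))) < p.
  have -> : z * (alpha * (p / (z * y'))) = p * (alpha / y') by field; rewrite !gt_eqF.
  by rewrite gtr_pMr // ltr_pdivrMr //; lra.
by rewrite mulrN nmulr_rlt0; lra.
Qed.

Lemma P_phase_lower : exists k : R, forall theta,
  - angle_bound < theta -> theta < angle_bound -> stabilizes NP DP (expNi theta) (tofrac k%:P).
Proof.
have pz0 : 0 < p / z by rewrite divr_gt0.
(* This gain makes the square in [PI_phase_upper] vanish, so the stability condition becomes exactly
   [cos theta > cos angle_bound]. *)
exists (- Num.sqrt (p / z)) => theta t1 t2; apply: P_sufficient.
have k0 : 0 < Num.sqrt (p / z) by rewrite sqrtr_gt0.
have k2 : Num.sqrt (p / z) ^+ 2 = p / z by rewrite sqr_sqrtr // ltW.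
have km : Num.sqrt (p / z) * Num.sqrt (p * z) = p.
  rewrite -sqrtrM ?ltW // (_ : p / z * (p * z) = p ^+ 2); last by field; rewrite gt_eqF.
  by rewrite sqrtr_sqr gtr0_norm.
have abpi : angle_bound < pi.
  by apply: lt_trans (atan_ltpi2 _) _; have := pi_gt0 R; lra.
have Cgt : 2 * Num.sqrt (p * z) / (p + z) < cos theta.
  rewrite -cos_angle_bound // -(cos_norm theta) ltr_cos.
  - by rewrite ltr_norml t1.
  - by rewrite in_itv /= normr_ge0 ler_norml /=; lra.
  - by rewrite in_itv /= angle_bound_ge0 //=; lra.
move: Cgt; rewrite ltr_pdivrMr ?addr_gt0 // => Cgt.
have CS := cos2Dsin2 theta.
move: (Num.sqrt (p / z)) k0 k2 km => k k0 k2 km.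
have zk : z * k ^+ 2 = p by rewrite k2 mulrCA divff ?mulr1 // gt_eqF.
rewrite /expNi; simpc => /=.
rewrite [ltLHS](_ : _ = p + (cos theta ^+ 2 + sin theta ^+ 2) * (z * k ^+ 2) - k * (cos theta * (p + z)));
  last by ring.
have : k * (2 * Num.sqrt (p * z)) < k * (cos theta * (p + z)) by rewrite ltr_pM2l.
by rewrite CS zk; move: km; lra.
Qed.
End PLowerBounds.

(** * First-order controllers for the gain margin, and a root criterion for the phase margin *)

Section GainLowerBound.
Local Open Scope complex_scope.
Variable R : realType.
Variables p z : R.
Hypotheses (hp : 0 < p) (hz : 0 < z).
Local Notation NP := ('X - z%:P : {poly R}).
Local Notation DP := ('X - p%:P : {poly R}).
Local Notation ratio_bound := (P_gain_bound p z).
Local Notation angle_bound := (P_phase_bound p z).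

Lemma real_quadratic_root_lt0 (a b c : R) (s : R[i]) : 0 < a -> 0 < b -> 0 < c ->
  a%:C * s ^+ 2 + b%:C * s + c%:C = 0 -> complex.Re s < 0.
Proof.
case: s => x y a0 b0 c0 /eqP; rewrite eq_complex expr2; simpc => /= /andP[/eqP h1 /eqP h2].
rewrite ltNge; apply/negP => x0.
have y0 : y * (a * x *+ 2 + b) = 0 by move: h2; lra.
move/eqP: y0; rewrite mulf_eq0 => /orP[/eqP y0|/eqP e]; last first.
  by have := mulr_ge0 (ltW a0) x0; lra.
move: h1; rewrite y0 => h1.
have := mulr_ge0 (ltW a0) (mulr_ge0 x0 x0); have := mulr_ge0 (ltW b0) x0; lra.
Qed.

Lemma gain_lower y : y < ratio_bound ^+ 2 ->
  exists K, forall alpha, 1 <= alpha -> alpha < y -> stabilizes NP DP alpha%:C K.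
Proof.
move=> yr; have [y1|y1] := leP y 1.
  by exists 0 => alpha a1 a2; move: (le_lt_trans a1 a2); rewrite ltNge y1.
(* The zero at [- z] gives [(s - z) * (s + z) = s ^+ 2 - z ^+ 2], so [a] leaves the middle
   coefficient [b - p] alone. The other two coefficients must share its sign; multiplying by [b - p]
   makes all three positive. *)
have stab a b alpha : 0 < (1 - alpha * a) * (b - p) ->
    0 < (alpha * a * z ^+ 2 - p * b) * (b - p) ->
    stabilizes NP DP alpha%:C
      (tofrac ((- a) *: 'X + (- (a * z))%:P) / tofrac (1 *: 'X + b%:P)).
  move=> h1 h2; apply: stabilizes_first_order; first exact: oner_neq0.
    rewrite -rmorphM -rmorphD fmorph_eq0 mulrN.
    by apply: contraTneq h1 => ->; rewrite mul0r ltxx.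
  have b0 : 0 < (b - p) * (b - p).
    rewrite -expr2 exprn_even_gt0 //=.
    by apply: contraTneq h1 => ->; rewrite mulr0 ltxx.
  move=> s hs; apply: (real_quadratic_root_lt0 h1 b0 h2 (s := s)).
  rewrite -[RHS](mulr0 (b - p)%:C) -{}hs.
  by rewrite !(rmorphM, rmorphB, rmorphD, rmorphN, rmorph1, rmorphXn) /=; ring.
have [pz|zp] := ltP p z.
  have {}yr : y < z ^+ 2 / p ^+ 2.
    rewrite -expr_div_n (lt_le_trans yr) //.
    by rewrite (_ : ratio_bound = z / p) //; apply/max_idPr;
      rewrite ler_pdivrMr // mulrAC
        ler_pdivlMr // -!expr2 ler_pXn2r ?nnegrE ?(ltW hp) ?(ltW hz) ?(ltW pz).
  have y0 : 0 < y by lra.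
  (* For [a = 1 / y] the requirement is [p < b < z ^+ 2 / (p * y)]; the midpoint is taken. *)
  pose b := (p + z ^+ 2 / (p * y)) / 2.
  have pp : 0 < p ^+ 2 by rewrite exprn_gt0.
  have py : 0 < p * y by rewrite mulr_gt0.
  have yb : p < z ^+ 2 / (p * y).
    by rewrite ltr_pdivlMr // mulrA -expr2 mulrC -ltr_pdivlMr.
  have bp : p < b by rewrite /b; lra.
  have bz : p * b * y < z ^+ 2.
    by rewrite mulrAC mulrC -ltr_pdivlMr // /b; lra.
  exists (tofrac ((- y^-1) *: 'X + (- (y^-1 * z))%:P) / tofrac (1 *: 'X + b%:P)).
  move=> alpha a1 a2; apply: stab; rewrite mulr_gt0 ?subr_gt0 //.
    by rewrite ltr_pdivrMr // mul1r.
  rewrite mulrAC ltr_pdivlMr //; apply: (lt_le_trans bz).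
  by rewrite ler_peMl // sqr_ge0.
have {}yr : y < p ^+ 2 / z ^+ 2.
  rewrite -expr_div_n (lt_le_trans yr) //.
  by rewrite (_ : ratio_bound = p / z) //; apply/max_idPl;
      rewrite ler_pdivrMr // mulrAC
        ler_pdivlMr // -!expr2 ler_pXn2r ?nnegrE ?(ltW hp) ?(ltW hz).
have y0 : 0 < y by lra.
pose b := (p + z ^+ 2 * y / p) / 2.
have zz : 0 < z ^+ 2 by rewrite exprn_gt0.
have yb : z ^+ 2 * y / p < p.
  by rewrite ltr_pdivrMr // -expr2 mulrC -ltr_pdivlMr.
have bp : b < p by rewrite /b; lra.
have bz : z ^+ 2 * y < p * b.
  by rewrite mulrC [p * b]mulrC -ltr_pdivrMr // [y * _]mulrC /b; lra.
have pb0 : 0 < p * b by apply: lt_trans bz; rewrite mulr_gt0.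
(* Here all coefficients are negative. This [a] exceeds 1 and gives
   [alpha * a * z ^+ 2 = p * b * (alpha / y)], which is below [p * b] for [alpha < y]. *)
pose a := p * b / (z ^+ 2 * y).
have a0 : 0 < a by rewrite divr_gt0 // mulr_gt0.
exists (tofrac ((- a) *: 'X + (- (a * z))%:P) / tofrac (1 *: 'X + b%:P)).
move=> alpha a1 a2; apply: stab; rewrite nmulr_lgt0 ?subr_lt0 //.
  have : 1 < a by rewrite ltr_pdivlMr ?mulr_gt0 // mul1r.
  move=> h; apply: (lt_le_trans h); by rewrite ler_peMl // ltW.
have -> : alpha * a * z ^+ 2 = p * b * (alpha / y).
  by rewrite /a; field; rewrite !gt_eqF.
by rewrite gtr_pMr // ltr_pdivrMr // mul1r.
Qed.

(** The constant coefficient is [q] times the conjugate of the leading one. This forces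
    [(A +i* B) * s] to be real or [|s|^2 = q]. The first case uses only the sign of [A * G]; in the
    second, [q * B ^+ 2 < G ^+ 2] keeps [|B * v|] below [A * G]. *)
Lemma phase_quadratic_root_lt0 (A B G q : R) (s : R[i]) :
    0 < q -> 0 < A * G -> q * B ^+ 2 < G ^+ 2 ->
    (A +i* B) * s ^+ 2 + (2 * G)%:C * s + q%:C * (A -i* B) = 0 ->
  complex.Re s < 0.
Proof.
case: s => x y q0 AG hG /eqP; rewrite eq_complex expr2; simpc => /= /andP[/eqP h1 /eqP h2].
(* With [Y = (A + iB) s = u + iv] and [r = |s|^2], multiplying the equation by the
   conjugate of [s] gives [Y r + 2 G r + q Y^* = 0]. *)
pose u := A * x - B * y; pose v := A * y + B * x; pose r := x ^+ 2 + y ^+ 2.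
have {}h1 : A * (x * x - y * y) - B * (2 * x * y) + 2 * G * x + q * A = 0 by move: h1; lra.
have {}h2 : A * (2 * x * y) + B * (x * x - y * y) + 2 * G * y - q * B = 0 by move: h2; lra.
have e1 : u * (r + q) = - (2 * G * r).
  have := congr2 (fun a b => x * a + y * b) h1 h2; rewrite /u /r /= !mulr0; lra.
have e2 : v * (r - q) = 0.
  have := congr2 (fun a b => x * b - y * a) h1 h2; rewrite /v /r /= !mulr0; lra.
have A0 : A != 0 by apply: contraTneq AG => ->; rewrite mul0r ltxx.
have n0 : 0 < A ^+ 2 + B ^+ 2.
  by rewrite ltr_wpDr ?sqr_ge0 // exprn_even_gt0.
have r0 : 0 < r.
  rewrite lt_neqAle addr_ge0 ?sqr_ge0 // andbT eq_sym paddr_eq0 ?sqr_ge0 // !sqrf_eq0.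
  apply: contraNN A0 => /andP[/eqP x0 /eqP y0]; move: h1; rewrite x0 y0 => h1.
  by rewrite -(mulrI_eq0 _ (mulfI (lt0r_neq0 q0))); apply/eqP; move: h1; lra.
suff : A * u + B * v < 0.
  rewrite (_ : A * u + B * v = (A ^+ 2 + B ^+ 2) * x); last by rewrite /u /v; ring.
  by rewrite pmulr_rlt0.
have uA : A * u < 0.
  have rq : 0 < r + q by rewrite addr_gt0.
  rewrite -(pmulr_llt0 _ rq) -mulrA e1 mulrN oppr_lt0 [ltRHS](_ : _ = A * G * (2 * r));
    last by ring.
  by rewrite (mulr_gt0 AG) // mulr_gt0.
move/eqP: e2; rewrite mulf_eq0 => /orP[/eqP v0|]; first by rewrite v0 mulr0 addr0.
rewrite subr_eq0 => /eqP rq.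
have uG : u = - G.
  have n2 : 2 * r != 0 by rewrite gt_eqF // mulr_gt0.
  by apply: (mulIf n2); move: e1; rewrite -rq; lra.
have uv : u ^+ 2 + v ^+ 2 = (A ^+ 2 + B ^+ 2) * q by rewrite -rq /u /v /r; ring.
have hBv : (B * v) ^+ 2 < (A * G) ^+ 2.
  have A2 : 0 < A ^+ 2 by rewrite exprn_even_gt0.
  have h : A ^+ 2 * (q * B ^+ 2) < A ^+ 2 * G ^+ 2 by rewrite ltr_pM2l.
  have h' : 0 <= B ^+ 2 * (G ^+ 2 - q * B ^+ 2) by rewrite mulr_ge0 ?sqr_ge0 // subr_ge0 ltW.
  have vE : v ^+ 2 = (A ^+ 2 + B ^+ 2) * q - G ^+ 2 by rewrite -uv uG; ring.
  by rewrite !exprMn vE; lra.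
rewrite uG mulrN; have := hBv; rewrite -ltr_sqrt; last by rewrite exprn_even_gt0 //= gt_eqF.
rewrite !sqrtr_sqr (gtr0_norm AG) => h.
by have := ler_norm (B * v); lra.
Qed.
End GainLowerBound.

(** * First-order controllers for the phase margin *)

Section PhaseLowerBound.
Local Open Scope complex_scope.
Variable R : realType.
Variables p z : R.
Hypotheses (hp : 0 < p) (hz : 0 < z).
Local Notation NP := ('X - z%:P : {poly R}).
Local Notation DP := ('X - p%:P : {poly R}).
Local Notation ratio_bound := (P_gain_bound p z).
Local Notation angle_bound := (P_phase_bound p z).

(** At [l = 1] the last inequality is the hypothesis. The sign condition dictates on which side of 1
    to move, and [d] is small enough to keep at least half of the slack. *)
Lemma lead_exists (T : R) : 0 <= T -> 2 * T < `|z - p| ->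
  exists l, [/\ 0 < l, 0 < (l - 1) * (z - l * p) & (l + 1) * T < `|z - l * p|].
Proof.
move=> T0; have [zp|pz] := ltP z p.
  rewrite ltr0_norm ?subr_lt0 // opprB => hT.
  pose d := (p - z - 2 * T) / (2 * p).
  have p2 : 0 < 2 * p by rewrite mulr_gt0.
  have d0 : 0 < d by rewrite divr_gt0 // subr_gt0.
  have d1 : d < 1 by rewrite ltr_pdivrMr // mul1r; move: hp hz; lra.
  have dp : d * p = (p - z - 2 * T) / 2 by rewrite /d; field; rewrite gt_eqF.
  have dT : 0 <= d * T by rewrite mulr_ge0 // ltW.
  have a : z - (1 - d) * p < 0 by move: dp; lra.
  exists (1 - d); split; first by lra.
    by rewrite nmulr_rgt0; lra.
  by rewrite ltr0_norm //; move: dp dT; lra.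
rewrite ger0_norm ?subr_ge0 // => hT.
pose d := (z - p - 2 * T) / (2 * (p + T)).
have pT : 0 < p + T by rewrite ltr_wpDr.
have d0 : 0 < d by rewrite divr_gt0 ?mulr_gt0 // subr_gt0.
have dp : d * (p + T) = (z - p - 2 * T) / 2 by rewrite /d; field; rewrite gt_eqF.
have dT : 0 <= d * T by rewrite mulr_ge0 // ltW.
have a : 0 < z - (1 + d) * p by move: dp dT; lra.
exists (1 + d); split; first by lra.
  by rewrite mulr_gt0 //; lra.
by rewrite gtr0_norm //; move: dp dT; lra.
Qed.

(** The zero [- l * p] and the pole [- z / l] give leading coefficient [l - c] and constant
    coefficient [p * z * (l * c - 1)]. For [|c| = 1] the latter is [p * z * c] times the conjugate
    of the former. *)
Lemma lead_stabilizes (l theta : R) :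
    0 < l -> 0 < (l - 1) * (z - l * p) -> 0 < cos (theta / 2) ->
    p * z * ((l + 1) * sin (theta / 2)) ^+ 2 < ((z - l * p) * cos (theta / 2)) ^+ 2 ->
  stabilizes NP DP (expNi theta)
    (tofrac ((-1) *: 'X + (- (p * l))%:P) / tofrac (l *: 'X + z%:P)).
Proof.
move=> l0 hl C0 hS.
have thE : theta = theta / 2 *+ 2 by rewrite -mulr_natr divfK.
have CS := cos2Dsin2 (theta / 2).
rewrite {1}thE /expNi cos_mulr2n sin_mulr2n.
move: (cos _) (sin _) C0 hS CS => C S C0 hS CS.
(* Multiplying the characteristic equation by [w = e^(i theta/2)] gives it the
   shape of phase_quadratic_root_lt0. *)
set c := Complex _ _; pose w := C +i* S; pose u := C -i* S.
have cw : c * w = u.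
  rewrite /c /w /u; simpc; congr (_ +i* _).
    have -> : C ^+ 2 *+ 2 - 1 = C ^+ 2 - S ^+ 2 by rewrite -CS; ring.
    by transitivity (C * (C ^+ 2 + S ^+ 2)); [ring | rewrite CS mulr1].
  have -> : C ^+ 2 *+ 2 - 1 = C ^+ 2 - S ^+ 2 by rewrite -CS; ring.
  by transitivity (- S * (C ^+ 2 + S ^+ 2)); [ring | rewrite CS mulr1].
have XE : (l - 1) * C +i* ((l + 1) * S) = l%:C * w - u.
  by rewrite /w /u; simpc; congr (_ +i* _); ring.
have XE' : (l - 1) * C -i* ((l + 1) * S) = l%:C * u - w.
  by rewrite /w /u; simpc; congr (_ +i* _); ring.
have CE : (2 * ((z - l * p) * C))%:C = (z - l * p)%:C * (w + u).
  by rewrite /w /u; simpc; congr (_ +i* _); ring.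
have AG : 0 < (l - 1) * C * ((z - l * p) * C).
  by rewrite mulrACA mulr_gt0 // mulr_gt0.
apply: stabilizes_first_order; first by rewrite gt_eqF.
  apply: contraTneq AG => E.
  suff : l%:C * w - u = 0 by rewrite -XE => -[-> _]; rewrite mul0r ltxx.
  rewrite -cw -mulrBl; rewrite (_ : l%:C - c = 0) ?mul0r //.
  by rewrite -E rmorphN1 mulrN1.
move=> s hs; have pz0 : 0 < p * z by rewrite mulr_gt0.
apply: (phase_quadratic_root_lt0 pz0 AG hS (s := s)).
rewrite XE XE' CE -[RHS](mulr0 w) -{}hs.
rewrite !(rmorphM, rmorphB, rmorphD, rmorphN, rmorphN1) /=.
have -> a b : w * (a + c * b) = w * a + u * b by rewrite mulrDr mulrA (mulrC w c) cw.
ring.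
Qed.

Lemma phase_lower y : 0 <= y -> y < 2 * angle_bound ->
  exists K, forall theta, - y < theta -> theta < y -> stabilizes NP DP (expNi theta) K.
Proof.
move=> y0 ya; set m := Num.sqrt (p * z).
have m0 : 0 < m by rewrite sqrtr_gt0 mulr_gt0.
have m2 : m ^+ 2 = p * z by rewrite sqr_sqrtr // mulr_ge0 // ltW.
have abpi : angle_bound < pi / 2 := atan_ltpi2 _.
have inI (x : R) : - (pi / 2) < x < pi / 2 -> x \in `](- (pi / 2)), (pi / 2)[ by rewrite in_itv.
(* After division by [cos (theta / 2) ^+ 2], the inequality of [lead_stabilizes] bounds
   [m * (l + 1) * |tan (theta / 2)|]; [m * tau] is the [T] of [lead_exists]. *)
pose tau := tan (y / 2).
have tau0 : 0 <= tau.
  rewrite leNgt -tan0 ltr_tan ?inI //; lra.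
have taum : 2 * (m * tau) < `|z - p|.
  have : tau < `|z - p| / (2 * m).
    rewrite /tau -[ltRHS]atanK ltr_tan ?inI // -/angle_bound; lra.
  by rewrite ltr_pdivlMr ?mulr_gt0 //; lra.
have [|l [l0 hl hT]] := lead_exists _ taum; first by rewrite mulr_ge0 // ltW.
exists (tofrac ((-1) *: 'X + (- (p * l))%:P) / tofrac (l *: 'X + z%:P)) => theta t1 t2.
have C0 : 0 < cos (theta / 2) by apply: cos_gt0_pihalf; lra.
apply: lead_stabilizes => //.
have SE : sin (theta / 2) = tan (theta / 2) * cos (theta / 2) by rewrite /tan divfK // gt_eqF.
have tt : `|tan (theta / 2)| <= tau.
  by rewrite ler_norml /tau -tanN !ltW // ltr_tan ?inI //; lra.
have C2 : 0 < cos (theta / 2) ^+ 2 by rewrite exprn_gt0.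
rewrite [ltLHS](_ : _ = (m * ((l + 1) * tan (theta / 2))) ^+ 2 * cos (theta / 2) ^+ 2); last first.
  by rewrite SE -m2; ring.
rewrite [ltRHS]exprMn ltr_pM2r // -real_normK ?num_real // -[ltRHS]real_normK ?num_real //.
rewrite ltr_pXn2r ?nnegrE //; apply: le_lt_trans hT.
rewrite normrM (gtr0_norm m0) normrM (gtr0_norm (addr_gt0 l0 ltr01)) mulrCA.
by apply: (ler_wpM2l (ltW (addr_gt0 l0 ltr01))); apply: (ler_wpM2l (ltW m0)).
Qed.
End PhaseLowerBound.

(** * Margins as suprema, and the final comparison *)

Section Margins.
Local Open Scope complex_scope.
Variable R : realType.
Implicit Types (NP DP : {poly R}) (X : set (controller R)).

Lemma gain_marginE X NP DP (v : R) :
    (forall K mu, X K ->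
       (forall alpha, 1 <= alpha -> alpha < mu -> stabilizes NP DP alpha%:C K) ->
       mu <= v) ->
    (forall mu, mu < v -> exists2 K, X K &
       forall alpha, 1 <= alpha -> alpha < mu -> stabilizes NP DP alpha%:C K) ->
  gain_margin X NP DP = v%:E.
Proof.
move=> hub hlb; apply/eqP; rewrite eq_le; apply/andP; split.
  by apply: ge_ereal_sup => _ [mu [K XK hK] <-]; rewrite lee_fin; exact: (hub K).
apply/lee_subgt0Pr => e e0; apply: ereal_sup_ubound.
by exists (v - e) => //; apply: hlb; rewrite ltrBlDr ltrDl.
Qed.

Lemma phase_marginE X NP DP (v : R) : 0 <= v -> v <= pi ->
    (forall K eta, X K ->
       (forall theta, - eta < theta -> theta < eta -> stabilizes NP DP (expNi theta) K) ->
       eta <= v) ->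
    (exists K, X K) ->
    (forall eta, 0 <= eta -> eta < v -> exists2 K, X K &
       forall theta, - eta < theta -> theta < eta -> stabilizes NP DP (expNi theta) K) ->
  phase_margin X NP DP = v.
Proof.
move=> v0 vpi hub [K0 XK0] hlb.
rewrite /phase_margin; set S := (X in sup X).
(* For [eta = 0] the range of angles is empty, so any controller of [X] shows that the set is
   nonempty. *)
have S0 : S 0.
  split; first by rewrite lexx pi_ge0.
  by exists K0 => // theta t1 t2; move: (lt_trans t1 t2); rewrite oppr0 ltxx.
have Sub : ubound S v by move=> eta [_ [K XK hK]]; exact: (hub K).
apply/eqP; rewrite eq_le; apply/andP; split; first by apply: ge_sup => //; exists 0.
rewrite leNgt; apply/negP => sv.
have s0 : 0 <= sup S by apply: ub_le_sup => //; exists v.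
pose y := (sup S + v) / 2.
suff /(ub_le_sup (ex_intro _ v Sub)) : S y by rewrite /y; lra.
split; first by rewrite /y; lra.
by apply: hlb; rewrite /y; lra.
Qed.

End Margins.

Lemma ctrlP_sub_ctrlPI (R : realType) : @ctrlP R `<=` @ctrlPI R.
Proof. by move=> K [k ->]; exists k, 0; rewrite !rmorph0 mul0r addr0. Qed.

Theorem corollary3p1 (R : realType) (p z : R) (hp : 0 < p) (hz : 0 < z) :
  let NP : {poly R} := 'X - z%:P in
  let DP : {poly R} := 'X - p%:P in
  let kM (X : set (controller R)) : \bar R := gain_margin X NP DP in
  let thetaM (X : set (controller R)) : R := phase_margin X NP DP in
  [/\ log10 (kM setT) = (2%:E * log10 (kM (@ctrlPI R)))%E,
      (2%:E * log10 (kM (@ctrlPI R)))%E = (2%:E * log10 (kM (@ctrlP R)))%E,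
      thetaM setT = 2 * thetaM (@ctrlPI R)
    & 2 * thetaM (@ctrlPI R) = 2 * thetaM (@ctrlP R)].
Proof.
move=> NP DP kM thetaM.
pose r := P_gain_bound p z; pose a := P_phase_bound p z.
have r0 : 0 < r by apply: lt_le_trans (ratio_bound_ge1 _ _).
have a0 : 0 <= a by exact: angle_bound_ge0.
have api : a < pi / 2 by exact: atan_ltpi2.
have gT : kM setT = (r ^+ 2)%:E.
  apply: gain_marginE => [K mu _|mu /(gain_lower hp hz)[K hK]].
    exact: gain_upper.
  by exists K.
(* P and PI are treated together: the lower bound comes from P controllers, the upper bound from PI
   controllers. *)
have gX X : @ctrlP R `<=` X -> X `<=` @ctrlPI R -> kM X = r%:E.
  move=> PX XPI; apply: gain_marginE => [K mu /XPI[kp [ki ->]]|mu /(P_gain_lower hp hz)[k hk]].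
    exact: PI_gain_upper.
  by exists (tofrac k%:P) => //; apply: PX; exists k.
have tT : thetaM setT = 2 * a.
  apply: phase_marginE; [by lra | by lra | | by exists 0 |].
    by move=> K eta _; exact: phase_upper.
  by move=> eta e0 ea; have [K hK] := phase_lower hp hz e0 ea; exists K.
have tX X : @ctrlP R `<=` X -> X `<=` @ctrlPI R -> thetaM X = a.
  move=> PX XPI; have [k hk] := P_phase_lower hp hz.
  have Xk : X (tofrac k%:P) by apply: PX; exists k.
  apply: phase_marginE; [by [] | by lra | | by exists (tofrac k%:P) |].
    by move=> K eta /XPI[kp [ki ->]]; exact: PI_phase_upper.
  by move=> eta e0 ea; exists (tofrac k%:P) => // theta t1 t2; apply: hk; rewrite -/a; lra.
have PPI := @ctrlP_sub_ctrlPI R.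
rewrite gT tT !gX ?tX //; split=> //.
by rewrite /log10 !lne_EFin ?exprn_gt0 // -!EFinM lnXn // mulr_natl mulrnAl.
Qed.
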